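(* Let $r$ and $b$ be two positive integers with $1\leq b\leq r-1$. Then there exists a graph $G=G_{r,b}$ such that $\operatorname{reg}(S/J_G)=r$ and the number of extremal Betti numbers of $S/J_G$ is $b$.
   Context: $\mathbb{K}$ is an arbitrary field and all graphs are finite and simple. For a graph $G$, put $S=\mathbb{K}[x_u,y_u : u\in V(G)]$, standard graded; the binomial edge ideal $J_G\subset S$ is generated by the binomials $x_uy_w-x_wy_u$ with $\{u,w\}\in E(G)$. For a finitely generated graded $S$-module $M$, $\beta_{i,i+j}^S(M)=\dim_{\mathbb{K}}\operatorname{Tor}_i^S(M,\mathbb{K})_{i+j}$ and $\operatorname{reg}(M)=\max\{j:\beta_{i,i+j}^S(M)\neq0\text{ for some }i\}$. A nonzero graded Betti number $\beta_{i,i+j}^S(M)$ is called an extremal Betti number if $\beta_{a,a+c}^S(M)=0$ for all pairs $(a,c)\neq(i,j)$ with $a\geq i$ and $c\geq j$; the number of extremal Betti numbers is the number of such positions $(i,j)$. *)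

(* Defs.v *)
From HB Require Import structures.
From mathcomp Require Import all_boot all_order all_algebra.
From mathcomp.multinomials Require Import mpoly.
From Stdlib Require Import ClassicalEpsilon.

Set Implicit Arguments.
Unset Strict Implicit.
Unset Printing Implicit Defensive.

Import GRing.Theory.
Local Open Scope ring_scope.

(** * Graded Betti numbers of S/I, for S = K[X_1, ..., X_n] *)

(* A sequence of finitely generated graded free S-modules and matrices

     ... -> F_2 --diff 1--> F_1 --diff 0--> F_0 --aug--> S

   where F_i is the direct sum of the S(- shift i k) for k < rank i.  Elements
   of F_i are row vectors, and maps act by multiplication on the right.
   Shifts are in nat because only modules S/I, which live in nonnegative
   degrees, are resolved. *)
Record free_complex (K : fieldType) (n : nat) := FreeComplex {
  frank : nat -> nat;
  fshift : forall i, 'I_(frank i) -> nat;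
  fdiff : forall i, 'M[{mpoly K[n]}]_(frank i.+1, frank i);
  faug : 'cV[{mpoly K[n]}]_(frank 0)
}.

(* The matrices are of degree 0 as maps of graded modules: a basis element of
   degree d goes to a homogeneous element of degree d. *)
Definition graded_complex (K : fieldType) (n : nat) (F : free_complex K n) :=
  (forall i (k : 'I_(frank F i.+1)) (l : 'I_(frank F i)),
     if (fshift l <= fshift k)%N
     then fdiff F i k l \is (fshift k - fshift l)%N.-homog
     else fdiff F i k l == 0)
  /\ (forall k : 'I_(frank F 0), faug F k 0 \is (fshift k).-homog).

(* F, augmented by the class of aug modulo I, is a graded free resolution
   ... -> F_1 -> F_0 -> S/I -> 0. *)
Definition graded_free_resolution (K : fieldType) (n : nat)
    (I : {mpoly K[n]} -> Prop) (F : free_complex K n) : Prop :=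
  [/\ graded_complex F,
      forall f : {mpoly K[n]}, exists v : 'rV_(frank F 0),
        I (f - (v *m faug F) 0 0),
      forall v : 'rV_(frank F 0),
        I ((v *m faug F) 0 0) <-> exists w, v = w *m fdiff F 0
    & forall i (v : 'rV_(frank F i.+1)),
        v *m fdiff F i = 0 <-> exists w, v = w *m fdiff F i.+1].

(* F (x)_S K: since K = S/(X_1, ..., X_n), each entry of a matrix is replaced
   by its constant coefficient. *)
Definition tensor_diff (K : fieldType) (n : nat) (F : free_complex K n) (i : nat)
    : 'M[K]_(frank F i.+1, frank F i) :=
  map_mx (mcoeff 0%MM) (fdiff F i).

(* The row space of this matrix is (F_i (x) K)_d, spanned by the basis elements
   of degree d. *)
Definition tensor_degree (K : fieldType) (n : nat) (F : free_complex K n)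
    (i d : nat) : 'M[K]_(frank F i) :=
  diag_mx (\row_k (fshift k == d)%:R).

Definition tensor_cycles (K : fieldType) (n : nat) (F : free_complex K n)
    (i d : nat) : 'M[K]_(frank F i) :=
  match i with
  | 0 => tensor_degree F 0 d
  | j.+1 => (tensor_degree F j.+1 d :&: kermx (tensor_diff F j))%MS
  end.

Definition tensor_boundaries (K : fieldType) (n : nat) (F : free_complex K n)
    (i d : nat) : 'M[K]_(frank F i.+1, frank F i) :=
  tensor_degree F i.+1 d *m tensor_diff F i.

(* dim_K H_i(F (x)_S K)_d; the subtraction is exact when F is a graded complex,
   as boundaries are then cycles of the same degree. *)
Definition tensor_homology_dim (K : fieldType) (n : nat) (F : free_complex K n)
    (i d : nat) : nat :=
  (\rank (tensor_cycles F i d) - \rank (tensor_boundaries F i d))%N.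

Definition zero_complex (K : fieldType) (n : nat) : free_complex K n :=
  @FreeComplex K n (fun=> 0%N) (fun _ _ => 0%N) (fun=> 0) 0.

(* A chosen graded free resolution of S/I; it exists when the ideal I is
   homogeneous, by Hilbert's basis theorem. *)
Definition resolution (K : fieldType) (n : nat) (I : {mpoly K[n]} -> Prop)
    : free_complex K n :=
  epsilon (inhabits (zero_complex K n)) (graded_free_resolution I).

(* betti I i d = dim_K Tor_i^S(S/I, K)_d; the internal degree is d, so that
   beta_{i, i + j} is betti I i (i + j). *)
Definition betti (K : fieldType) (n : nat) (I : {mpoly K[n]} -> Prop)
    (i d : nat) : nat :=
  tensor_homology_dim (resolution I) i d.

(** * Regularity and extremal Betti numbers *)

Definition has_regularity (beta : nat -> nat -> nat) (r : nat) : Prop :=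
  (exists i, beta i (i + r)%N <> 0%N)
  /\ (forall i j, beta i (i + j)%N <> 0%N -> (j <= r)%N).

Definition extremal (beta : nat -> nat -> nat) (p : nat * nat) : Prop :=
  let: (i, j) := p in
  beta i (i + j)%N <> 0%N
  /\ (forall a c, (a, c) <> (i, j) -> (i <= a)%N -> (j <= c)%N ->
        beta a (a + c)%N = 0%N).

Definition extremal_number (beta : nat -> nat -> nat) (b : nat) : Prop :=
  exists s : seq (nat * nat),
    [/\ uniq s, size s = b & forall p, p \in s <-> extremal beta p].

(** * Binomial edge ideals *)

(* The name symmetric alone denotes a predicate of the library mpoly. *)
Definition simple_graph (V : finType) (E : rel V) : Prop :=
  ssrbool.symmetric E /\ irreflexive E.

Section BinomialEdgeIdeal.
Variables (K : fieldType) (V : finType).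

(* The variables x_u and y_u are indexed by the two copies of V in V + V. *)
Definition xvar (u : V) : {mpoly K[#|{: V + V}|]} := 'X_(enum_rank (inl u)).
Definition yvar (u : V) : {mpoly K[#|{: V + V}|]} := 'X_(enum_rank (inr u)).

Definition edge_binomial (u w : V) : {mpoly K[#|{: V + V}|]} :=
  xvar u * yvar w - xvar w * yvar u.

(* Each edge {u, w} occurs as (u, w) and as (w, u), which give opposite
   binomials. *)
Definition binomial_edge_ideal (E : rel V) (f : {mpoly K[#|{: V + V}|]}) : Prop :=
  exists c : V * V -> {mpoly K[#|{: V + V}|]},
    f = \sum_(p | E p.1 p.2) c p * edge_binomial p.1 p.2.

End BinomialEdgeIdeal.

(* Main.v *)
Require Import Defs.
From mathcomp Require Import all_boot all_order all_algebra.
From mathcomp.multinomials Require Import mpoly.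
From mathcomp Require Import zify ring.
From Stdlib Require Import Classical ClassicalEpsilon.

Set Implicit Arguments.
Unset Strict Implicit.
Unset Printing Implicit Defensive.

Import GRing.Theory.
Local Open Scope ring_scope.

(** Betti numbers are computed as Koszul homology. If J_G has the profile
    "Tor_i(S/J_G, K)_{i+j} is nonzero only for j <= r and i <= p (max j lo), and
    is nonzero at i = p j for lo <= j <= r", with p decreasing on [lo, r], then
    the regularity is r and the extremal positions are the r - lo + 1 pairs
    (p j, j). Adding a disjoint edge adds a regular quadric to J_G, which shifts
    the profile by (1, 1), so that r and lo both increase by one. For lo = 3, a
    cone with apex v over G and sufficiently many isolated vertices W decreases
    lo to 2 at the same r: J = Q /\ Y with Q = J_{K_{W + v}} and
    Y = (x_v, y_v) + J_G, and in the Mayer-Vietoris sequence of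
    0 -> S/J -> S/Q (+) S/Y -> S/(Q + Y) -> 0 the complete graph in
    Q + Y = (x_v, y_v) + J_{K_W} creates a new corner in row 2, while Y only
    shifts the rows j >= 3 by two homological degrees. Starting from the empty
    graph, two edges, then b - 1 times an edge and a cone, then r - b - 1 more
    edges give regularity r and b extremal Betti numbers. *)

(** * Koszul complexes *)

(** Extremal positions depend only on which Tor groups vanish, so no dimension is computed: [tor_nz]
    is a proposition, and exact sequences are used as implications between nonvanishing groups. The
    obstacle is that [betti] is read off a resolution picked by [epsilon], which is meaningful only
    once some graded free resolution is known to exist. Koszul homology needs no resolution, and it
    also produces one: the bound j <= r contained in a profile bounds the degrees of the generators
    of every syzygy module, so finitely many generators suffice at each stage. In the cone, S/Q and
    S/(Q + Y) live in rows 0 and 1 only, and the connecting map raises the row by one; hence the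
    cone can disturb nothing above row 2. The size of W is chosen so large that the new corner in
    row 2 lies strictly to the right of all the others. It is then extremal, and it dominates
    everything in rows 0 and 1. The next edge pushes it up to row 3, which makes room for another
    cone. *)

Section Koszul.
Variables (K : fieldType) (n : nat) (U : lmodType {mpoly K[n]}).
Implicit Types (X Y : {set 'I_n}) (k l : 'I_n) (c e : {set 'I_n} -> U).

Definition ksign X k : {mpoly K[n]} := (-1) ^+ #|[set l in X | (l < k)%N]|.

(** [c X] is the coefficient of the exterior basis element e_X; the sum collects what the boundaries
    of the e_Y with Y = [k |: X] contribute to e_X. *)
Definition kdiff c X : U :=
  \sum_(k | k \notin X) (ksign X k * 'X_k) *: c (k |: X).

(** Exterior multiplication by e_k. *)
Definition khtpy k c X : U := 
  if k \in X then ksign (X :\ k) k *: c (X :\ k) else 0.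

Lemma ksignU X k l : k \notin X ->
  ksign (k |: X) l = (-1) ^+ (k < l)%N * ksign X l.
Proof.
move=> kX; rewrite /ksign.
have -> : [set x in k |: X | (x < l)%N] =
          (if (k < l)%N then k |: [set x in X | (x < l)%N] else [set x in X | (x < l)%N]).
  apply/setP => x; case: ifP => kl; rewrite !inE; case: (eqVneq x k) => [->|] //=;
    by rewrite kl ?andbF.
by case: ifP => _; rewrite ?mul1r ?expr0 // cardsU1 inE (negbTE kX) exprD.
Qed.

Lemma ksign_swap X k l : k \notin X -> l \notin X -> k != l ->
  ksign (k |: X) l * ksign X k = - (ksign (l |: X) k * ksign X l).
Proof.
move=> kX lX kl; rewrite !ksignU // mulrAC -mulrA [X in _ = - X]mulrAC -[X in _ = - X]mulrA -mulNr.
rewrite [ksign X l * _]mulrC; congr (_ * _).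
by move: kl; rewrite -(inj_eq val_inj) /=; case: ltngtP => //=; rewrite ?opprK.
Qed.

Lemma ksign_sqr X k : ksign X k * ksign X k = 1.
Proof. by rewrite /ksign -expr2 sqrr_sign. Qed.

Lemma kdiff_kdiff c X : kdiff (kdiff c) X = 0.
Proof.
have Fanti (k l : 'I_n) : k \notin X -> l \notin k |: X ->
    (ksign X k * 'X_k) *: ((ksign (k |: X) l * 'X_l) *: c (l |: (k |: X))) =
    - ((ksign X l * 'X_l) *: ((ksign (l |: X) k * 'X_k) *: c (k |: (l |: X)))).
  move=> kX; rewrite !inE negb_or => /andP[lk lX].
  rewrite !scalerA -scaleNr setUCA; congr (_ *: _).
  have -> : ksign X k * 'X_k * (ksign (k |: X) l * 'X_l) =
    (ksign (k |: X) l * ksign X k) * ('X_l * 'X_k).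
    by rewrite mulrACA [_ * ksign X k]mulrC ['X_l * _]mulrC.
  rewrite ksign_swap // 1?eq_sym // mulNr; congr (- _).
  by rewrite [ksign (l |: X) k * _]mulrC mulrACA.
(* The sum over k < l cancels against the sum over l < k. *)
pose G (k l : 'I_n) :=
  (ksign X k * 'X_k) *: ((ksign (k |: X) l * 'X_l) *: c (l |: (k |: X))).
have -> : kdiff (kdiff c) X =
    \sum_(l | l \notin X) \sum_(k | (k \notin X) && (k != l)) G l k.
  rewrite /kdiff; apply: eq_bigr => l lX; rewrite scaler_sumr; apply: eq_bigl => k.
  by rewrite !inE negb_or andbC.
have split_lt (l : 'I_n) : \sum_(k | (k \notin X) && (k != l)) G l k =
   \sum_(k | (k \notin X) && (k < l)%N) G l k + \sum_(k | (k \notin X) && (l < k)%N) G l k.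
  rewrite (bigID (fun k : 'I_n => (k < l)%N)) /=; congr (_ + _); apply: eq_bigl => k;
  rewrite -(inj_eq val_inj) /=; by case: ltngtP; rewrite /= ?andbT ?andbF.
under eq_bigr => l _ do rewrite split_lt.
rewrite big_split /= [X in _ + X](exchange_big_dep (fun k => k \notin X)) /=; last by move=> ? ? _ /andP[].
rewrite -big_split /= big1 // => l lX.
have -> : \sum_(i | (i \notin X) && ((l \notin X) && (i < l)%N)) G i l
        = \sum_(i | (i \notin X) && (i < l)%N) G i l.
  apply: eq_bigl => i; apply/and3P/andP => [[-> _ ->]|[iX il]]; split=> //.
rewrite -big_split /= big1 // => k /andP[kX kl].
rewrite /G Fanti ?addNr // !inE negb_or kX andbT.
by rewrite -(inj_eq val_inj) /= ltn_eqF.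
Qed.

(** Cartan's formula: exterior multiplication by e_k makes multiplication by the variable X_k
    null-homotopic. Linear combinations of it serve the same purpose for a regular element in
    [tor_regular_le]. *)
Lemma khtpyP k c X : kdiff (khtpy k c) X + khtpy k (kdiff c) X = 'X_k *: c X.
Proof.
rewrite /khtpy; case: ifP => kX.
  set Y := X :\ k.
  have kY : k \notin Y by rewrite !inE eqxx.
  have XE : X = k |: Y by rewrite setD1K.
  rewrite {2}/kdiff (bigD1 k) //= -XE scalerDr addrCA scalerA mulrA ksign_sqr mul1r.
  rewrite -[RHS]addr0; congr (_ + _).
  rewrite /kdiff scaler_sumr [X in _ + X](eq_bigl (fun l => l \notin X)); last first.
    by move=> l; rewrite !inE negb_and negbK; case: eqP => [->|] /=; rewrite ?kX ?andbF ?andbT.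
  rewrite -big_split /= big1 // => l lX.
  have lk : l != k by apply: contra lX => /eqP->.
  have -> : k \in l |: X by rewrite !inE kX orbT.
  have -> : (l |: X) :\ k = l |: Y.
    by apply/setP => x; rewrite !inE; case: (eqVneq x l) => [->|] //=; rewrite lk.
  rewrite !scalerA -scalerDl mulrA mulrAC -mulrDl {1}XE.
  have lY : l \notin Y by rewrite !inE negb_and lX orbT.
  have -> : ksign (k |: Y) l * ksign (l |: Y) k = - (ksign Y k * ksign Y l).
    rewrite !ksignU // mulrACA [ksign Y k * _]mulrC -[RHS]mulN1r; congr (_ * _).
    by move: lk; rewrite -(inj_eq val_inj) /=; case: ltngtP => //=; rewrite ?mul1r ?mulr1.
  by rewrite addNr mul0r scale0r.
rewrite addr0 /kdiff (bigD1 k) ?kX //= setU11.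
have -> : (k |: X) :\ k = X by rewrite setU1K ?kX.
rewrite scalerA mulrAC ksign_sqr mul1r big1 ?addr0 // => l /andP[lX lk].
by rewrite !inE eq_sym (negbTE lk) kX scaler0.
Qed.

Lemma kdiffD c e X : kdiff (fun Y => c Y + e Y) X = kdiff c X + kdiff e X.
Proof. by rewrite /kdiff -big_split; apply: eq_bigr => k _; rewrite scalerDr. Qed.

Lemma kdiffZ a c X : kdiff (fun Y => a *: c Y) X = a *: kdiff c X.
Proof.
by rewrite /kdiff scaler_sumr; apply: eq_bigr => k _; rewrite !scalerA mulrC.
Qed.

Lemma kdiffN c X : kdiff (fun Y => - c Y) X = - kdiff c X.
Proof. by rewrite /kdiff -sumrN; apply: eq_bigr => k _; rewrite scalerN. Qed.

Lemma kdiffB c e X : kdiff (fun Y => c Y - e Y) X = kdiff c X - kdiff e X.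
Proof. by rewrite (kdiffD c (fun Y => - e Y)) kdiffN. Qed.

Lemma kdiff_sum (I : finType) (c : I -> {set 'I_n} -> U) X :
  kdiff (fun Y => \sum_i c i Y) X = \sum_i kdiff (c i) X.
Proof.
rewrite /kdiff exchange_big /=; apply: eq_bigr => k _.
by rewrite scaler_sumr.
Qed.

Lemma eq_kdiff c e X : c =1 e -> kdiff c X = kdiff e X.
Proof. by move=> ce; apply: eq_bigr => k _; rewrite ce. Qed.

Definition kchain (i : nat) c := forall X, #|X| != i -> c X = 0.

Lemma kchain_kdiff i c : kchain i.+1 c -> kchain i (kdiff c).
Proof.
move=> ci X Xi; rewrite /kdiff big1 // => k kX; rewrite ci ?scaler0 //.
by rewrite cardsU1 kX.
Qed.

Lemma kchain0_kdiff c X : kchain 0 c -> kdiff c X = 0.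
Proof. by move=> ci; rewrite /kdiff big1 // => k kX; rewrite ci ?scaler0 // cardsU1 kX. Qed.

Lemma kchain_khtpy k i c : kchain i c -> kchain i.+1 (khtpy k c).
Proof.
move=> ci X Xi; rewrite /khtpy; case: ifP => // kX; rewrite ci ?scaler0 //.
by move: Xi; rewrite (cardsD1 k) kX.
Qed.

Lemma kchainB i c e : kchain i c -> kchain i e -> kchain i (fun X => c X - e X).
Proof. by move=> ci ei X Xi; rewrite ci // ei // subr0. Qed.

End Koszul.

Lemma fun_choice (T T' : Type) (P : T -> T' -> Prop) :
  (forall x, exists y, P x y) -> exists f, forall x, P x (f x).
Proof.
move=> h; pose g x := constructive_indefinite_description _ (h x).
by exists (fun x => proj1_sig (g x)) => x; apply: (proj2_sig (g x)).
Qed.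

(* The degrees are shifted by one: [ghom G d.+1] is the component of degree [d],
   and [ghom G 0] stands for degree -1, so that a chain with coefficients in
   [ghom G d] has its boundary in [ghom G d.+1] without any side condition. *)
Record grading (K : fieldType) (n : nat) (U : lmodType {mpoly K[n]}) := Grading {
  ghom :> nat -> U -> Prop;
  ghom0 : forall d, ghom d 0;
  ghomB : forall d u v, ghom d u -> ghom d v -> ghom d (u - v);
  ghomX : forall d k u, ghom d u -> ghom d.+1 ('X_k *: u);
  ghom_neg : forall u, ghom 0 u -> u = 0
}.

Definition is_submod (R : pzRingType) (U : lmodType R) (A : U -> Prop) :=
  A 0 /\ forall a u v, A u -> A v -> A (a *: u + v).

Section Submod.
Variables (R : pzRingType) (U : lmodType R) (A : U -> Prop).
Hypothesis sA : is_submod A.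

Lemma submod0 : A 0. Proof. by case: sA. Qed.

Lemma submodZ a u : A u -> A (a *: u).
Proof. by move=> Au; rewrite -[_ *: _]addr0; apply: (proj2 sA) => //; apply: submod0. Qed.

Lemma submodD u v : A u -> A v -> A (u + v).
Proof. by move=> Au Av; rewrite -[u]scale1r; apply: (proj2 sA). Qed.

Lemma submodB u v : A u -> A v -> A (u - v).
Proof. by move=> Au Av; apply: submodD => //; rewrite -scaleN1r; apply: submodZ. Qed.

Lemma submod_sum (I : Type) (r : seq I) (P : pred I) (F : I -> U) :
  (forall i, P i -> A (F i)) -> A (\sum_(i <- r | P i) F i).
Proof. by move=> h; apply: big_ind => //; [apply: submod0|apply: submodD]. Qed.

End Submod.

(** * Koszul homology of subquotients and its long exact sequence *)

Section Tor.
Variables (K : fieldType) (n : nat) (U : lmodType {mpoly K[n]}) (G : grading U).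
Implicit Types (A B C : U -> Prop) (c e : {set 'I_n} -> U).

Lemma ghomN d u : G d u -> G d (- u).
Proof. by move=> h; rewrite -sub0r; apply: ghomB => //; apply: ghom0. Qed.

Lemma ghomD d u v : G d u -> G d v -> G d (u + v).
Proof. by move=> hu hv; rewrite -[v]opprK; apply: ghomB => //; apply: ghomN. Qed.

Lemma ghom_sum d (I : Type) (r : seq I) (P : pred I) (F : I -> U) :
  (forall i, P i -> G d (F i)) -> G d (\sum_(i <- r | P i) F i).
Proof. by move=> h; apply: big_ind => //; [apply: ghom0|apply: ghomD]. Qed.

Lemma ghom_ksign d X k u : G d u -> G d (ksign K X k *: u).
Proof.
rewrite /ksign -signr_odd => h; case: (odd _); rewrite ?expr0 ?scale1r // expr1 scaleN1r.
exact: ghomN.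
Qed.

Lemma ghom_kdiff d c X : (forall Y, G d (c Y)) -> G d.+1 (kdiff c X).
Proof.
move=> h; apply: ghom_sum => k _; rewrite -scalerA; apply: ghom_ksign; exact: ghomX.
Qed.

Lemma ghom_khtpy d c k X : (forall Y, G d (c Y)) -> G d (khtpy k c X).
Proof.
by move=> h; rewrite /khtpy; case: ifP => _; [apply: ghom_ksign|apply: ghom0].
Qed.

Lemma submod_kdiff A c X : is_submod A -> (forall Y, A (c Y)) -> A (kdiff c X).
Proof. by move=> sA h; apply: submod_sum => // k _; apply: submodZ. Qed.

Lemma submod_khtpy A c k X : is_submod A -> (forall Y, A (c Y)) -> A (khtpy k c X).
Proof.
by move=> sA h; rewrite /khtpy; case: ifP => _; [apply: submodZ|apply: submod0].
Qed.

Definition chain_in A i d c := [/\ kchain i c, forall X, A (c X) & forall X, G d (c X)].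

Lemma chain_inB A i d c e : is_submod A -> chain_in A i d c -> chain_in A i d e ->
  chain_in A i d (fun X => c X - e X).
Proof.
move=> sA [c1 c2 c3] [e1 e2 e3]; split=> [|X|X]; first exact: kchainB.
  exact: submodB.
exact: ghomB.
Qed.

Lemma chain_in0 A i d : is_submod A -> chain_in A i d (fun=> 0).
Proof. by move=> sA; split=> // X; [apply: submod0|apply: ghom0]. Qed.

Lemma chain_inD A i d c e : is_submod A -> chain_in A i d c -> chain_in A i d e ->
  chain_in A i d (fun X => c X + e X).
Proof.
move=> sA [c1 c2 c3] [e1 e2 e3]; split=> [X Xi|X|X]; first by rewrite c1 // e1 // addr0.
  exact: submodD.
exact: ghomD.
Qed.

Lemma chain_in_kdiff A i d c : is_submod A -> chain_in A i.+1 d c ->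
  chain_in A i d.+1 (kdiff c).
Proof.
move=> sA [c1 c2 c3]; split=> [|X|X]; first exact: kchain_kdiff.
  exact: submod_kdiff.
exact: ghom_kdiff.
Qed.

Lemma chain_in_sub A B i d c : (forall u, A u -> B u) -> chain_in A i d c ->
  chain_in B i d c.
Proof. by move=> AB [c1 c2 c3]; split=> // X; apply: AB. Qed.

(* The nonvanishing of Tor_i(A/B, K)_{i+j}, computed as Koszul homology. *)
Definition tor_nz A B i j := exists c,
  [/\ chain_in A i j.+1 c, forall X, B (kdiff c X)
    & forall e, chain_in A i.+1 j e -> ~ forall X, B (c X - kdiff e X)].

Lemma kdiff_boundary A B i j c : ~ tor_nz A B i j -> chain_in A i j.+1 c ->
  (forall X, B (kdiff c X)) ->
  exists e, chain_in A i.+1 j e /\ forall X, B (c X - kdiff e X).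
Proof.
move=> nT cA dc; case: (classic (exists e, chain_in A i.+1 j e /\ forall X, B (c X - kdiff e X))) => // nE.
by case: nT; exists c; split=> // e eA h; apply: nE; exists e.
Qed.

Lemma tor_nz_vanish A B i j : is_submod A ->
  (forall u, A u -> G j.+1 u -> B u) -> ~ tor_nz A B i j.
Proof.
move=> sA AB [c [[c1 c2 c3] _ /(_ _ (chain_in0 _ _ sA))]]; apply=> X.
rewrite /kdiff big1 ?subr0 => [|k _]; last by rewrite scaler0.
exact: AB.
Qed.

Section LongExact.
Variables A B C : U -> Prop.
Hypotheses (sA : is_submod A) (sB : is_submod B) (sC : is_submod C).
Hypotheses (BA : forall u, B u -> A u) (AC : forall u, A u -> C u).

(** This lemma and the next two are exactness at the three kinds of terms of the long sequence of 0
    -> A/B -> C/B -> C/A -> 0: a nonzero group has a nonzero neighbour. The connecting map preserves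
    the internal degree i + j, so it lowers i by one and raises j by one. *)
Lemma tor_nz_mid i j : tor_nz C B i j -> tor_nz A B i j \/ tor_nz C A i j.
Proof.
move=> [c [cC dc nc]]; case: (classic (tor_nz C A i j)) => [|nT]; [by right|left].
have [f [fC hf]] := kdiff_boundary nT cC (fun X => BA (dc X)).
exists (fun X => c X - kdiff f X); split.
- have [h1 _ h3] := chain_inB sC cC (chain_in_kdiff sC fC); by split.
- by move=> X; rewrite kdiffB kdiff_kdiff subr0.
move=> e eA h; apply: (nc (fun X => f X + e X)).
  by apply: chain_inD => //; apply: chain_in_sub eA.
by move=> X; rewrite kdiffD opprD addrA.
Qed.

Lemma tor_nz_conn i j : tor_nz C A i j ->
  tor_nz C B i j \/ exists i', i = i'.+1 /\ tor_nz A B i' j.+1.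
Proof.
move=> [c [cC dc nc]]; case: i cC nc => [|i] cC nc.
  left; exists c; split=> // [X|e eC h]; last by apply: (nc _ eC) => X; apply: BA.
  by rewrite kchain0_kdiff; [apply: submod0|case: cC].
case: (classic (tor_nz A B i j.+1)) => [T|nT]; [by right; exists i|left].
have dcA : chain_in A i j.+2 (kdiff c).
  by have [h1 _ h3] := chain_in_kdiff sC cC; split.
have [a [aA ha]] : exists a, chain_in A i.+1 j.+1 a /\ forall X, B (kdiff c X - kdiff a X).
  by apply: (kdiff_boundary nT dcA) => X; rewrite kdiff_kdiff; apply: submod0.
exists (fun X => c X - a X); split.
- by apply: chain_inB => //; apply: chain_in_sub aA.
- by move=> X; rewrite kdiffB.
move=> f fC h; apply: (nc _ fC) => X.
have -> : c X - kdiff f X = (c X - a X - kdiff f X) + a X by rewrite addrAC subrK.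
by apply: submodD => //; [apply: BA|case: aA].
Qed.

Lemma tor_nz_sub i j : tor_nz A B i j ->
  tor_nz C B i j \/ exists j', j = j'.+1 /\ tor_nz C A i.+1 j'.
Proof.
move=> [c [cA dc nc]]; case: (classic (tor_nz C B i j)) => [|nT]; [by left|right].
have [f [fC hf]] := kdiff_boundary nT (chain_in_sub AC cA) dc.
have dfA X : A (kdiff f X).
  have -> : kdiff f X = c X - (c X - kdiff f X) by rewrite opprB addrC subrK.
  by apply: submodB => //; [case: cA|apply: BA].
(* For j = 0 the coefficients of [f] have degree -1 and vanish, so [c] already lies in B, against
   its choice. *)
case: j cA nc nT fC => [|j] cA nc nT fC.
  case: (nc _ (chain_in0 _ _ sA)) => X; have := hf X.
  by rewrite !(@eq_kdiff _ _ _ f (fun=> 0)) // => Y; case: fC => _ _ /(_ Y) /ghom_neg.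
exists j; split=> //; exists f; split=> // g gC h.
apply: (nc (fun X => f X - kdiff g X)).
  by have [h1 _ h3] := chain_inB sC fC (chain_in_kdiff sC gC); split.
by move=> X; rewrite kdiffB kdiff_kdiff subr0.
Qed.

End LongExact.

Lemma eq_tor_nz A A' B B' i j : (forall u, A u <-> A' u) -> (forall u, B u <-> B' u) ->
  tor_nz A B i j -> tor_nz A' B' i j.
Proof.
move=> AA BB [c [cA dc nc]]; exists c; split.
- by apply: chain_in_sub cA => u /AA.
- by move=> X; apply/BB.
move=> e eA h; apply: (nc e).
  by apply: chain_in_sub eA => u /AA.
by move=> X; apply/BB.
Qed.

End Tor.

(** * Transport of Tor along an isomorphism of subquotients *)

Section Transfer.
Variables (K : fieldType) (n : nat) (U V : lmodType {mpoly K[n]}).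
Variables (G : grading U) (H : grading V) (phi : U -> V) (s : nat).
Variables (A B : U -> Prop) (A' B' : V -> Prop).
Hypothesis sA : is_submod A.
Hypothesis sB' : is_submod B'.
Hypothesis phi_lin : forall a u v, phi (a *: u + v) = a *: phi u + phi v.
Hypothesis phi_hom : forall d u, G d u -> H (d + s)%N (phi u).
Hypothesis phiA : forall u, A u -> A' (phi u).
Hypothesis phiB : forall u, A u -> (B u <-> B' (phi u)).
Hypothesis phi_onto : forall d v, A' v -> H (d + s)%N v ->
  exists u, [/\ A u, G d u & B' (v - phi u)].

Let phi0 : phi 0 = 0.
Proof.
have := phi_lin 1 0 0; rewrite !scale1r add0r => /eqP.
by rewrite -subr_eq0 opprD addrA subrr sub0r oppr_eq0 => /eqP.
Qed.

Let phiD u v : phi (u + v) = phi u + phi v.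
Proof. by rewrite -[u]scale1r phi_lin !scale1r. Qed.

Let phiZ a u : phi (a *: u) = a *: phi u.
Proof. by rewrite -[a *: u]addr0 phi_lin phi0 addr0. Qed.

Let phi_sub u v : phi (u - v) = phi u - phi v.
Proof. by rewrite phiD -scaleN1r phiZ scaleN1r. Qed.

Let phi_kdiff c X : phi (kdiff c X) = kdiff (fun Y => phi (c Y)) X.
Proof.
rewrite /kdiff; elim/big_rec2: _ => [|k x y _ <-]; first exact: phi0.
by rewrite phiD phiZ.
Qed.

Let phi_chain i d c : chain_in G A i d c -> chain_in H A' i (d + s)%N (fun X => phi (c X)).
Proof.
case=> c1 c2 c3; split=> X; [|exact: phiA|exact: phi_hom].
by move=> Xi; rewrite c1.
Qed.

Let lift_chain i d c : chain_in H A' i (d + s)%N c ->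
  exists f, chain_in G A i d f /\ forall X, B' (c X - phi (f X)).
Proof.
case=> c1 c2 c3.
have [f hf] : exists f, forall X, [/\ A (f X), G d (f X), B' (c X - phi (f X)) & #|X| != i -> f X = 0].
  apply: (@fun_choice _ _ (fun X u => [/\ A u, G d u, B' (c X - phi u) & #|X| != i -> u = 0])) => X.
  case: (eqVneq #|X| i) => Xi.
    by have [u [? ? ?]] := phi_onto (c2 X) (c3 X); exists u.
  exists 0; split=> //; [exact: submod0|exact: ghom0|].
  by rewrite c1 // phi0 subr0; apply: submod0.
exists f; split; first by split=> X; case: (hf X).
by move=> X; case: (hf X).
Qed.

(** The hypotheses make [phi] induce an isomorphism of degree [s] from A/B onto A'/B'; chains are
    pushed forward by [phi] and lifted one coefficient at a time. At d = 0, [phi_onto] forces the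
    elements of A' of degree s - 1 into B'; this case occurs because for j = 0 the chains whose
    boundaries are divided out have degree -1 in the source. *)
Lemma tor_nz_transfer i j : tor_nz G A B i j <-> tor_nz H A' B' i (j + s)%N.
Proof.
split=> -[c [cA dc nc]].
  exists (fun X => phi (c X)); split.
  - exact: (phi_chain cA).
  - by move=> X; rewrite -phi_kdiff -phiB //; apply: submod_kdiff => //; case: cA.
  move=> e eA h; have [f [fA hf]] := lift_chain eA.
  apply: (nc f fA) => X; rewrite phiB; last first.
    by apply: submodB => //; [case: cA | apply: submod_kdiff => //; case: fA].
  rewrite phi_sub phi_kdiff.
  have -> : phi (c X) - kdiff (fun Y => phi (f Y)) X = 
   (phi (c X) - kdiff e X) + kdiff (fun Y => e Y - phi (f Y)) X.
    by rewrite kdiffB addrA subrK.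
  by apply: submodD => //; apply: submod_kdiff.
have [f [fA hf]] := lift_chain (d := j.+1) cA.
exists f; split=> // [X|e eA h].
  rewrite phiB; last by apply: submod_kdiff => //; case: fA.
  rewrite phi_kdiff.
  have -> : kdiff (fun Y => phi (f Y)) X = kdiff c X - kdiff (fun Y => c Y - phi (f Y)) X.
    by rewrite kdiffB opprB addrC subrK.
  by apply: submodB => //; apply: submod_kdiff.
apply: (nc _ (phi_chain eA)) => X.
have -> : c X - kdiff (fun Y => phi (e Y)) X = (c X - phi (f X)) + phi (f X - kdiff e X).
  by rewrite phi_sub phi_kdiff addrA subrK.
apply: submodD => //; rewrite -phiB //.
by apply: submodB => //; [case: fA|apply: submod_kdiff => //; case: eA].
Qed.

End Transfer.

(** * Homogeneous ideals and regular elements *)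

Section Homogeneous.
Variables (K : fieldType) (n : nat).
Local Notation S := {mpoly K[n]}.
Implicit Types (f g : S).

Definition phom d f := if d is d'.+1 then f \is d'.-homog else f = 0.

Definition pproj d f : S := if d is d'.+1 then pihomog mdeg d' f else 0.

Lemma phom0 d : phom d 0.
Proof. by case: d => //= d; apply: dhomog0. Qed.

Lemma phomB d f g : phom d f -> phom d g -> phom d (f - g).
Proof.
case: d => /= [-> ->|d]; first by rewrite subrr.
by move=> hf hg; rewrite rpredB.
Qed.

Lemma phomM d e f g : phom d f -> g \is e.-homog -> phom (d + e)%N (g * f).
Proof.
case: d => /= [-> _|d hf hg]; first by rewrite mulr0; apply: phom0.
by rewrite addnC; apply: dhomogM.
Qed.

Lemma homog_X k : ('X_k : S) \is 1.-homog.
Proof. by rewrite dhomogX /= mdeg1. Qed.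

Lemma phomX d k f : phom d f -> phom d.+1 ('X_k * f).
Proof. by move=> h; rewrite -addn1; apply: phomM => //; apply: homog_X. Qed.

Lemma pprojB d f g : pproj d (f - g) = pproj d f - pproj d g.
Proof. by case: d => /= [|d]; rewrite ?subrr // pihomogB. Qed.

Lemma pprojD d f g : pproj d (f + g) = pproj d f + pproj d g.
Proof. by case: d => /= [|d]; rewrite ?addr0 // pihomogD. Qed.

Lemma pproj0 d : pproj d 0 = 0.
Proof. by case: d => //= d; rewrite pihomog0. Qed.

Lemma phom_pproj d f : phom d (pproj d f).
Proof. by case: d => //= d; apply: pihomogP. Qed.

Lemma pproj_id d f : phom d f -> pproj d f = f.
Proof. by case: d => //= d; apply: pihomog_dE. Qed.

Lemma pihomogM e d f g : g \is e.-homog ->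
  pihomog mdeg (e + d) (g * f) = g * pihomog mdeg d f.
Proof.
move=> hg; set k := maxn (msize f) d.+1.
rewrite {1}(@pihomog_partitionE _ _ mdeg k f) ?leq_maxl //.
rewrite mulr_sumr linear_sum /= (bigD1 (Ordinal (leq_maxr (msize f) d.+1))) //=.
rewrite pihomog_dE; last by apply: dhomogM => //; apply: pihomogP.
rewrite big1 ?addr0 // => i; rewrite -val_eqE /= => ne.
apply: (@pihomog_ne0 _ _ _ (e + i)); first by rewrite eqn_add2l.
by apply: dhomogM => //; apply: pihomogP.
Qed.

Lemma pihomogM_lt e d f g : g \is e.-homog -> (d < e)%N ->
  pihomog mdeg d (g * f) = 0.
Proof.
move=> hg lt; rewrite {1}(@pihomog_partitionE _ _ mdeg (msize f) f) //.
rewrite mulr_sumr linear_sum /= big1 // => i _.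
apply: (@pihomog_ne0 _ _ _ (e + i)).
  by rewrite gtn_eqF // ltn_addr.
by apply: dhomogM => //; apply: pihomogP.
Qed.

Lemma pprojM d e f g : g \is e.-homog -> pproj (d + e)%N (g * f) = g * pproj d f.
Proof.
move=> hg; case: d => [|d] /=; last by rewrite addnC; apply: pihomogM.
by rewrite mulr0; case: e hg => //= e hg; rewrite (pihomogM_lt _ hg).
Qed.

Lemma pprojM_le d e f g : g \is e.-homog -> (d <= e)%N -> pproj d (g * f) = 0.
Proof. by case: d => //= d hg lt; apply: pihomogM_lt hg lt. Qed.

Definition poly_grading : grading S^o :=
  @Grading K n S^o phom phom0 phomB phomX (fun u h => h).

Lemma phom_sum d (I : Type) (r : seq I) (P : pred I) (F : I -> S) :
  (forall i, P i -> phom d (F i)) -> phom d (\sum_(i <- r | P i) F i).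
Proof. exact: (@ghom_sum _ _ _ poly_grading). Qed.

Lemma phom_kdiff d (c : {set 'I_n} -> S^o) X :
  (forall Y, phom d (c Y)) -> phom d.+1 (kdiff c X).
Proof. exact: (@ghom_kdiff _ _ _ poly_grading). Qed.

Lemma phom_khtpy d (c : {set 'I_n} -> S^o) k X :
  (forall Y, phom d (c Y)) -> phom d (khtpy k c X).
Proof. exact: (@ghom_khtpy _ _ _ poly_grading). Qed.

(** The ideal generated by [P]. The inductive form gives induction over combinations of generators
    without indexing finite sums. *)
Inductive idl (P : S -> Prop) : S -> Prop :=
| Idl0 : idl P 0
| IdlD a f g : P f -> idl P g -> idl P (a * f + g).

Lemma idl_gen P f : P f -> idl P f.
Proof. by move=> Pf; rewrite -[f]mul1r -[_ * _]addr0; apply: IdlD => //; apply: Idl0. Qed.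

Lemma idl_submod P : @is_submod _ S^o (idl P).
Proof.
split=> [|a u v Pu Pv]; first exact: Idl0.
elim: Pu => [|b f g Pf _ IH]; first by rewrite scaler0 add0r.
rewrite scalerDr -addrA [_ *: _]mulrA; exact: IdlD.
Qed.

Lemma idlM P a f : idl P f -> idl P (a * f).
Proof. exact: (submodZ (idl_submod P)). Qed.

Lemma idlMr P a f : idl P f -> idl P (f * a).
Proof. by rewrite mulrC; apply: idlM. Qed.

Lemma idlAdd P f g : idl P f -> idl P g -> idl P (f + g).
Proof. exact: (submodD (idl_submod P)). Qed.

Lemma idlB P f g : idl P f -> idl P g -> idl P (f - g).
Proof. exact: (submodB (idl_submod P)). Qed.

Lemma idl_sub P Q : (forall f, P f -> idl Q f) -> forall f, idl P f -> idl Q f.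
Proof.
move=> PQ f; elim=> [|a g h Pg _ Qh]; first exact: Idl0.
by apply: idlAdd => //; apply/idlM/PQ.
Qed.

Lemma idlW (P Q : S -> Prop) : (forall f, P f -> Q f) -> forall f, idl P f -> idl Q f.
Proof. by move=> PQ; apply: idl_sub => f /PQ; apply: idl_gen. Qed.

Definition is_graded (I : S -> Prop) := forall d f, I f -> I (pproj d f).

Lemma idl_graded P : (forall f, P f -> exists e, f \is e.-homog) -> is_graded (idl P).
Proof.
move=> hP d f; elim=> [|a g h Pg _ IH]; first by rewrite pproj0; apply: Idl0.
rewrite pprojD; apply: idlAdd => //.
have [e he] := hP _ Pg; rewrite mulrC.
case: (leqP d e) => de; first by rewrite (pprojM_le _ he) //; apply: Idl0.
by rewrite -(subnK (ltnW de)) pprojM //; apply/idlMr/idl_gen.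
Qed.

Definition adj (P : S -> Prop) g f := P f \/ f = g.

Lemma adjP P g f : idl (adj P g) f <-> exists a, idl P (f - a * g).
Proof.
split=> [|[a h]].
  elim=> [|a h k [Ph|->] _ [b hb]].
  - by exists 0; rewrite mul0r subr0; apply: Idl0.
  - by exists b; rewrite -addrA; apply: IdlD.
  - by exists (a + b); rewrite mulrDl opprD addrACA subrr add0r.
rewrite -[f](subrK (a * g)); apply: idlAdd; last by apply/idlM/idl_gen; right.
by apply: idlW h => ? ?; left.
Qed.

Definition regular_mod (I : S -> Prop) g := forall f, I (g * f) -> I f.

Section Colon.
Variables (P Q : S -> Prop) (e : nat) (g : S).
Hypothesis P_homog : forall f, P f -> exists d, f \is d.-homog.
Hypothesis g_homog : g \is e.-homog.
Hypothesis colon : forall f, idl P (g * f) <-> idl Q f.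

(** Q is the colon ideal P : g, so multiplication by [g] identifies S/Q, shifted by [e], with (P,
    g)/P. *)
Lemma tor_colon i j : tor_nz poly_grading (fun=> True) (idl Q) i j <->
  tor_nz poly_grading (idl (adj P g)) (idl P) i (j + e)%N.
Proof.
apply: (@tor_nz_transfer K n S^o S^o poly_grading poly_grading
  (fun f : S^o => g *: f) e (fun=> True) (idl Q) (idl (adj P g)) (idl P)) => //.
- exact: idl_submod.
- by move=> a u v; rewrite scalerDr !scalerA mulrC.
- by move=> d u hu; apply: phomM.
- by move=> u _; apply/adjP; exists u; rewrite [g *: u]mulrC subrr; apply: Idl0.
- by move=> u _; rewrite -colon.
move=> d v /adjP[a ha] hv; exists (pproj d a); split=> //; first exact: phom_pproj.
have := idl_graded P_homog (d + e)%N ha; rewrite pprojB pproj_id //.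
by rewrite [a * g]mulrC pprojM.
Qed.

(** The module (P, g)/P is zero in degrees below [e], which excludes the rows j < e. *)
Lemma tor_colon_ge i j : tor_nz poly_grading (idl (adj P g)) (idl P) i j ->
  exists2 j', j = (j' + e)%N & tor_nz poly_grading (fun=> True) (idl Q) i j'.
Proof.
move=> T1; case: (leqP e j) => ej.
  by exists (j - e)%N; rewrite ?tor_colon subnK.
case: (tor_nz_vanish (idl_submod _) _ T1) => f /adjP[a ha] hf.
have := idl_graded P_homog j.+1 ha; rewrite pprojB pproj_id //.
by rewrite [a * g]mulrC (pprojM_le _ g_homog) ?subr0.
Qed.

End Colon.

(** * Quotients by a regular element *)

Section Regular.
Variables (P : S -> Prop) (e : nat) (g : S) (h : 'I_n -> S).
Hypothesis P_homog : forall f, P f -> exists d, f \is d.-homog.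
Hypothesis g_reg : regular_mod (idl P) g.
Hypothesis h_homog : forall k, h k \is e.-homog.
Hypothesis gE : g = \sum_k h k * 'X_k.

Local Notation T P := (tor_nz poly_grading (fun=> True) (idl P)).

Let sT : @is_submod _ S^o (fun=> True). Proof. by []. Qed.

Let g_homog : g \is e.+1.-homog.
Proof.
rewrite gE rpred_sum // => k _; rewrite -addn1; apply: dhomogM => //; exact: homog_X.
Qed.

(** The chain sum_k h_k e_k /\ c has boundary g c modulo P, by Cartan's formula, so it is a cycle
    modulo (P, g). In other words, multiplication by [g] is null-homotopic, and the connecting map
    of the long exact sequence is onto. *)
Lemma tor_regular_le i j : T P i j -> T (adj P g) i.+1 (j + e)%N.
Proof.
case=> [c [[c1 _ c3] dc nc]].
pose Hc X : S^o := \sum_k h k *: khtpy k c X.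
have dHc X : kdiff Hc X = g *: c X - \sum_k h k *: khtpy k (kdiff c) X.
  rewrite /Hc kdiff_sum gE scaler_suml -sumrB; apply: eq_bigr => k _.
  by rewrite kdiffZ -scalerA -scalerBr -khtpyP addrK.
have iH X : idl P (\sum_k h k *: khtpy k (kdiff c) X).
  apply: (submod_sum (idl_submod P)) => k _; apply: (submodZ (idl_submod P)).
  by apply: (@submod_khtpy K n S^o (idl P)) => //; apply: idl_submod.
exists Hc; split.
- split=> // X.
    by move=> Xi; rewrite /Hc big1 // => k _; rewrite (kchain_khtpy k c1) ?scaler0.
  apply: phom_sum => k _; rewrite -addSn; apply: phomM => //.
  exact: phom_khtpy.
- move=> X; rewrite dHc; apply: idlB; last by apply: idlW (iH X) => ? ?; left.
  by apply/adjP; exists (c X); rewrite [g *: _]mulrC subrr; apply: Idl0.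
move=> f [f1 _ f3] hf.
have [a ha] : exists a : {set 'I_n} -> S, forall X, 
    [/\ phom j (a X), idl P (Hc X - kdiff f X - a X * g) & #|X| != i.+1 -> a X = 0].
  apply: (@fun_choice _ _ (fun X a => [/\ phom j a, idl P (Hc X - kdiff f X - a * g) & #|X| != i.+1 -> a = 0])) => X.
  case: (eqVneq #|X| i.+1) => [Xi|Xi].
    have /adjP [a ha] := hf X; exists (pproj j a); split=> //; first exact: phom_pproj.
    have := idl_graded P_homog (j + e.+1)%N ha.
    rewrite pprojB [a * g]mulrC pprojM // pproj_id 1?mulrC //.
    rewrite addnS; apply: phomB; last exact: phom_kdiff.
    by apply: phom_sum => k _; rewrite -addSn; apply: phomM => //; apply: phom_khtpy.
  exists 0; split=> //; first exact: phom0.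
  have -> : Hc X = 0 by rewrite /Hc big1 // => k _; rewrite (kchain_khtpy k c1) ?scaler0.
  by rewrite (kchain_kdiff f1) // mul0r !subr0; apply: Idl0.
apply: (nc a); first by split=> // X; case: (ha X).
move=> X; apply: g_reg.
(* The chain [b] has coefficients in P, hence so does its boundary, which is g (c - d a) modulo P;
   regularity of [g] then makes [c] the boundary of [a]. *)
pose b X : S^o := Hc X - kdiff f X - g *: (a X : S^o).
have ib X' : idl P (b X') by rewrite /b [g *: _]mulrC; case: (ha X').
have := submod_kdiff X (idl_submod P) ib.
rewrite /b kdiffB kdiffB kdiff_kdiff subr0 kdiffZ dHc => h1.
have := idlAdd h1 (iH X); rewrite addrAC subrK.
by rewrite -[_ * (_ - _)]/(g *: (_ : S^o)) scalerBr.
Qed.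

(** Regularity says P : g = P, so (P, g)/P is a shifted copy of S/P, and the connecting map
    concludes. *)
Lemma tor_regular_ge i j : T (adj P g) i j ->
  T P i j \/ exists i' j', [/\ i = i'.+1, j = (j' + e)%N & T P i' j'].
Proof.
have PA f : idl P f -> idl (adj P g) f by apply: idlW => ? ?; left.
have colon f : idl P (g * f) <-> idl P f by split=> [/g_reg //|]; apply: idlM.
case/(tor_nz_conn (idl_submod _) (idl_submod P) sT PA (fun _ _ => I)) => [|[i' [-> T1]]]; [by left|right].
have [j' /eqP] := tor_colon_ge P_homog g_homog colon T1.
by rewrite addnS eqSS => /eqP -> T2; exists i', j'.
Qed.

End Regular.
End Homogeneous.

(** * Substituting zero for variables, and ideals generated by variables *)

Section Variables.
Variables (K : fieldType) (n : nat).
Local Notation S := {mpoly K[n]}.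
Implicit Types (f g : S) (X Y : {set 'I_n}).

Lemma mnm_neq0 (m : 'X_{1..n}) : m != 0%MM -> exists k m', m = (U_(k) + m')%MM.
Proof.
move=> m0; have [k mk] : exists k, (0 < m k)%N.
  apply/existsP; apply: contraR m0; rewrite negb_exists => /forallP h.
  by apply/eqP/mnmP => k; rewrite mnm0E; have := h k; rewrite -eqn0Ngt => /eqP.
exists k, (m - U_(k))%MM; rewrite addmC submK //.
by apply/mnm_lepP => l; rewrite mnm1E; case: eqP => [<-|].
Qed.

Lemma mpoly_var_ind (P : S -> Prop) :
  (forall c, P c%:MP) -> (forall f g, P f -> P g -> P (f + g)) ->
  (forall k f, P f -> P ('X_k * f)) -> forall f, P f.
Proof.
move=> PC PD PX; elim/mpolyind => [|c m p _ _]; first by rewrite -mpolyC0.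
apply: PD; have [d] := ubnP (mdeg m); elim: d m => // d IH m.
case: (eqVneq m 0%MM) => [->|/mnm_neq0 [k [m' ->]]].
  by rewrite mpolyX0 alg_mpolyC.
rewrite mdegD mdeg1 add1n ltnS => hd.
by rewrite mpolyXD scalerAr; apply/PX/IH.
Qed.

Lemma max_ideal_decomp f : f@_0%MM = 0 -> exists a : 'I_n -> S, f = \sum_k 'X_k * a k.
Proof.
suff [a fE] : exists a : 'I_n -> S, f = (f@_0%MM)%:MP + \sum_k 'X_k * a k.
  by move=> f0; exists a; rewrite {1}fE f0 mpolyC0 add0r.
elim/mpoly_var_ind: f => [c|f g [a ha] [b hb]|k f [a ha]].
- by exists (fun=> 0); rewrite mcoeffC eqxx mulr1 big1 ?addr0 // => k _; rewrite mulr0.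
- exists (fun k => a k + b k); rewrite {1}ha {1}hb mcoeffD mpolyCD addrACA -big_split.
  by congr (_ + _); apply: eq_bigr => k _; rewrite mulrDr.
exists (fun l => if l == k then f else 0).
rewrite [mcoeff _ _]rmorphM /= mcoeffX mnm1_eq0 mul0r mpolyC0 add0r.
by rewrite (bigD1 k) //= eqxx big1 ?addr0 // => l /negbTE->; rewrite mulr0.
Qed.

Definition kill X f : S := f \mPo [tuple (if i \in X then 0 else 'X_i) | i < n].

Lemma kill0 X : kill X 0 = 0. Proof. exact: comp_mpoly0. Qed.

Lemma killD X f g : kill X (f + g) = kill X f + kill X g.
Proof. exact: comp_mpolyD. Qed.

Lemma killB X f g : kill X (f - g) = kill X f - kill X g.
Proof. exact: comp_mpolyB. Qed.

Lemma killM X f g : kill X (f * g) = kill X f * kill X g.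
Proof. exact: rmorphM. Qed.

Lemma killX X k : kill X 'X_k = if k \in X then 0 else 'X_k.
Proof. by rewrite /kill comp_mpolyXU -tnth_nth tnth_mktuple. Qed.

Lemma killC X c : kill X c%:MP = c%:MP.
Proof. exact: comp_mpolyC. Qed.

Definition vars X f := exists2 k, k \in X & f = 'X_k.

Lemma kill_decomp X f : idl (vars X) (f - kill X f).
Proof.
elim/mpoly_var_ind: f => [c|f g hf hg|k f hf].
- by rewrite killC subrr; apply: Idl0.
- by rewrite killD opprD addrACA; apply: idlAdd.
rewrite killM killX; case: ifP => kX; last by rewrite -mulrBr; apply: idlM.
by rewrite mul0r subr0; apply/idlMr/idl_gen; exists k.
Qed.

Lemma kill1_decomp k f : exists a, f = kill [set k] f + 'X_k * a.
Proof.
suff [a ha] : exists a, f - kill [set k] f = 'X_k * a by exists a; rewrite -ha addrC subrK.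
elim: (kill_decomp [set k] f) => [|a g h [l /set1P -> ->] _ [b ->]]; first by exists 0; rewrite mulr0.
by exists (a + b); rewrite mulrDr mulrC.
Qed.

Lemma kill_idl X P : (forall f, P f -> idl P (kill X f)) ->
  forall f, idl P f -> idl P (kill X f).
Proof.
move=> hP f; elim=> [|a g h Pg _ IH]; first by rewrite kill0; apply: Idl0.
by rewrite killD killM; apply: idlAdd => //; apply/idlM/hP.
Qed.

(** When X_k occurs in no generator, every element of the ideal is its value at X_k = 0 plus X_k
    times another element of the ideal. For X_k f the first part is zero, so cancelling X_k shows
    that f is in the ideal. *)
Lemma regular_X P k : (forall f, P f -> kill [set k] f = f) -> regular_mod (idl P) 'X_k.
Proof.
move=> hP f hf.
have [h Ih hE] : exists2 h, idl P h & 'X_k * f = kill [set k] ('X_k * f) + 'X_k * h.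
  elim: hf => [|a g h Pg _ [h1 Ih hE]].
    by exists 0; rewrite ?kill0 ?mulr0 ?addr0 //; apply: Idl0.
  have [b hb] := kill1_decomp k a.
  exists (b * g + h1); first exact: IdlD.
  rewrite killD killM (hP _ Pg) [in LHS]hb [in LHS]hE mulrDl mulrDr mulrA -!addrA.
  by congr (_ + _); rewrite addrCA.
move: hE; rewrite killM killX inE eqxx mul0r add0r => /mulfI -> //.
by apply/eqP => /(congr1 (mcoeff U_(k)%MM))/eqP; rewrite mcoeffX eqxx mcoeff0 oner_eq0.
Qed.

Definition no_gen f := False.
Local Notation T P := (tor_nz (poly_grading K n) (fun=> True) (idl P)).

Lemma vars_homog X f : vars X f -> exists d, f \is d.-homog.
Proof. by case=> k _ ->; exists 1%N; apply: homog_X. Qed.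

Lemma eq_tor_idl P Q i j : (forall f, idl P f <-> idl Q f) -> T P i j <-> T Q i j.
Proof. by move=> h; split; apply: eq_tor_nz => // u; rewrite -?h; tauto. Qed.

Section AddVar.
Variables (P : S -> Prop) (k : 'I_n).
Hypotheses (P_homog : forall f, P f -> exists d, f \is d.-homog).
Hypothesis reg : regular_mod (idl P) 'X_k.

Let h l : S := (l == k)%:R.

Let h_homog l : h l \is 0.-homog.
Proof. by rewrite /h; case: eqP => _; [apply: dhomog1 | apply: dhomog0]. Qed.

Let hE : 'X_k = \sum_l h l * 'X_l.
Proof.
by rewrite (bigD1 k) //= /h eqxx mul1r big1 ?addr0 // => l /negbTE->; rewrite mul0r.
Qed.

Lemma tor_X_le i j : T P i j -> T (adj P 'X_k) i.+1 j.
Proof. by move=> h1; rewrite -[j]addn0; apply: (tor_regular_le P_homog reg h_homog). Qed.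

Lemma tor_X_ge i j : T (adj P 'X_k) i j -> T P i j \/ exists2 i', i = i'.+1 & T P i' j.
Proof.
case/(tor_regular_ge P_homog reg h_homog hE); first by left.
by move=> [i' [j' [-> -> h1]]]; right; exists i'; rewrite ?addn0.
Qed.

End AddVar.

Lemma vars_adj X k f : adj (vars X) 'X_k f <-> vars (k |: X) f.
Proof.
split=> [[[l lX ->]|->]|[l /setU1P [->|lX] ->]].
- by exists l => //; rewrite setU1r.
- by exists k => //; rewrite setU11.
- by right.
by left; exists l.
Qed.

Lemma regular_vars X k : k \notin X -> regular_mod (idl (vars X)) 'X_k.
Proof.
move=> kX; apply: regular_X => f [l lX ->]; rewrite killX inE.
by case: eqP => // lk; case/negP: kX; rewrite -lk.
Qed.

Lemma tor_vars_step X k i j : k \notin X -> T (vars X) i j -> T (vars (k |: X)) i.+1 j.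
Proof.
move=> kX /(tor_X_le (@vars_homog X) (regular_vars kX)).
by apply: (proj1 (eq_tor_idl _ _ _)); split; apply: idlW => g /vars_adj.
Qed.

Lemma tor_vars_setT i j : T (vars setT) i j -> (i <= n)%N /\ j = 0%N.
Proof.
move=> h; split.
  rewrite leqNgt; apply/negP => lt; case: h => c [[c1 _ _] _ /(_ _ (chain_in0 _ _ _ _))]; apply.
    by [].
  move=> X; rewrite c1; last first.
    by rewrite neq_ltn (leq_ltn_trans _ lt) // -[n in (_ <= n)%N]card_ord max_card.
  rewrite /kdiff big1 ?subrr; first exact: Idl0.
  by move=> k _; rewrite scaler0.
case: j h => // j h; case: (tor_nz_vanish _ _ h) => // f _ hf.
have [|a ->] := @max_ideal_decomp f.
  by apply: dhomog_nemf_coeff hf _; rewrite /= mdeg0.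
apply: (submod_sum (idl_submod (vars setT))) => k _; apply/idlMr/idl_gen.
by exists k; rewrite ?inE.
Qed.

(** Induction on the number of missing variables: adjoining one of them raises i by one, and with
    all variables adjoined i is at most n because there are no larger subsets of variables. *)
Lemma tor_vars X i j : T (vars X) i j -> (i <= #|X|)%N /\ j = 0%N.
Proof.
have [d] := ubnP (n - #|X|)%N; elim: d X i => // d IH X i hd h.
case: (set_0Vmem (~: X)) => [X0|[k]].
  have -> : X = setT by rewrite -[X]setCK X0 setC0.
  by rewrite cardsT card_ord; apply: tor_vars_setT; rewrite -[X]setCK X0 setC0 in h.
rewrite inE => kX; have Xn : (#|X| < n)%N.
  rewrite -[X in (_ < X)%N]card_ord -cardsT proper_card // properT.
  by apply/contra: kX => /eqP->; rewrite inE.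
have cX : #|k |: X| = #|X|.+1 by rewrite cardsU1 kX.
have hd' : (n - #|k |: X| < d)%N.
  by rewrite cX -ltnS; apply: leq_trans hd; rewrite ltnS ltn_sub2l.
by have := IH _ _ hd' (tor_vars_step kX h); rewrite cX ltnS.
Qed.

Lemma eq_vars0 f : idl (vars set0) f <-> idl no_gen f.
Proof.
split; last by apply: idlW.
by apply: idlW => g [k]; rewrite inE.
Qed.

Lemma idl_no_gen f : idl no_gen f <-> f = 0.
Proof. by split=> [[]|->] //; apply: Idl0. Qed.

Lemma tor_free i j : T no_gen i j -> i = 0%N /\ j = 0%N.
Proof.
move=> /(eq_tor_idl _ _ eq_vars0) /tor_vars [].
by rewrite cards0 leqn0 => /eqP.
Qed.

(** In row 0 boundaries come from coefficients of degree -1, so the constant chain 1 cannot be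
    one. *)
Lemma tor_free00 : T no_gen 0 0.
Proof.
exists (fun X => (X == set0)%:R : S^o); split.
- split=> // X; last by case: eqP => _; [apply: dhomog1 | apply: dhomog0].
  by rewrite -cards_eq0; case: eqP.
- by move=> X; rewrite kchain0_kdiff ?idl_no_gen // => Y; rewrite cards_eq0; case: eqP.
move=> e [_ _ e3] /(_ set0); rewrite eqxx idl_no_gen /kdiff big1 ?subr0.
  by move/eqP; rewrite oner_eq0.
by move=> k _; have /= -> := e3 (k |: set0); rewrite scaler0.
Qed.

Lemma tor_vars_max X : T (vars X) #|X| 0.
Proof.
have [d] := ubnP #|X|; elim: d X => // d IH X hd.
case: (set_0Vmem X) => [->|[k kX]].
  by rewrite cards0; apply/(eq_tor_idl _ _ eq_vars0)/tor_free00.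
have kX1 : k \notin X :\ k by rewrite !inE eqxx.
rewrite -(setD1K kX) cardsU1 kX1; apply: tor_vars_step => //; apply: IH.
by move: hd; rewrite (cardsD1 k X) kX add1n ltnS.
Qed.

End Variables.

(** * Graded free modules and resolutions *)

Section FreeModule.
Variables (K : fieldType) (n m : nat) (sh : 'I_m -> nat).
Local Notation S := {mpoly K[n]}.
Implicit Types (u v : 'rV[S]_m).

(** Truncated subtraction is exactly right for the shifted index: when it gives 0, the coordinate
    would have negative degree, and [phom 0] forces it to vanish. *)
Definition fhom d v := forall k, phom (d - sh k)%N (v 0 k).

Lemma fhom0 d : fhom d 0.
Proof. by move=> k; rewrite mxE; apply: phom0. Qed.

Lemma fhomB d u v : fhom d u -> fhom d v -> fhom d (u - v).
Proof. by move=> hu hv k; rewrite !mxE; apply: phomB. Qed.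

Lemma fhomX d k v : fhom d v -> fhom d.+1 ('X_k *: v).
Proof.
move=> hv l; rewrite mxE; have := hv l.
case: (leqP (sh l) d) => ld; first by rewrite subSn //; apply: phomX.
rewrite (eqP (_ : d - sh l == 0)%N) ?subn_eq0 1?ltnW //= => ->.
by rewrite mulr0; apply: phom0.
Qed.

Lemma fhom_neg v : fhom 0 v -> v = 0.
Proof. by move=> h; apply/rowP => k; rewrite mxE; have := h k; rewrite sub0n. Qed.

Definition free_grading : grading 'rV[S]_m := Grading fhom0 fhomB fhomX fhom_neg.

Definition fproj d v : 'rV[S]_m := \row_k pproj (d - sh k) (v 0 k).

Lemma fhom_fproj d v : fhom d (fproj d v).
Proof. by move=> k; rewrite mxE; apply: phom_pproj. Qed.

Lemma fproj_id d v : fhom d v -> fproj d v = v.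
Proof. by move=> h; apply/rowP => k; rewrite mxE pproj_id. Qed.

Lemma kdiff_coord (c : {set 'I_n} -> 'rV[S]_m) X k :
  kdiff c X 0 k = kdiff (fun Y => c Y 0 k : S^o) X.
Proof. by rewrite /kdiff summxE; apply: eq_bigr => l _; rewrite mxE. Qed.

Lemma tor_free_module i j :
  tor_nz free_grading (fun=> True) (fun v => v = 0) i j -> i = 0%N /\ exists k, j = sh k.
Proof.
case=> c [[c1 _ c3] dc nc]; apply: NNPP => nT.
have [e he] : exists e : 'I_m -> {set 'I_n} -> S^o, forall k,
    chain_in (poly_grading K n) (fun=> True) i.+1 (j - sh k) (e k) /\
    forall X, c X 0 k = kdiff (e k) X.
  apply: (@fun_choice _ _ (fun k e => chain_in (poly_grading K n) (fun=> True) i.+1 (j - sh k) e /\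
    forall X, c X 0 k = kdiff e X)) => k.
  case: (leqP (sh k) j) => kj; last first.
    exists (fun=> 0); split; first exact: chain_in0.
    move=> X; have := c3 X k; rewrite (eqP (_ : j.+1 - sh k == 0)%N) ?subn_eq0 //= => ->.
    by rewrite /kdiff big1 // => l _; rewrite scaler0.
  have nTk : ~ tor_nz (poly_grading K n) (fun=> True) (idl (@no_gen K n)) i (j - sh k).
    move=> /tor_free[i0 /eqP j0]; case: nT; split=> //; exists k.
    by apply/eqP; rewrite eqn_leq kj andbT -subn_eq0.
  have [||e [h1 h2]] := kdiff_boundary nTk (c := fun X => c X 0 k : S^o).
  - split=> // X; first by move=> Xi; rewrite c1 ?mxE.
    by have := c3 X k; rewrite subSn.
  - by move=> X; rewrite idl_no_gen -kdiff_coord dc mxE.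
  exists e; split=> // X; have /idl_no_gen/eqP := h2 X.
  by rewrite subr_eq0 => /eqP.
apply: (nc (fun X => \row_k e k X)).
  split=> // X.
    by move=> Xi; apply/rowP => k; rewrite !mxE; case: (he k) => -[k1 _ _] _; rewrite k1.
  by move=> k; rewrite mxE; case: (he k) => -[_ _ k3] _; apply: k3.
move=> X; apply/rowP => k; rewrite !mxE kdiff_coord.
rewrite (@eq_kdiff _ _ _ _ (e k)) => [|Y]; last by rewrite mxE.
by case: (he k) => _ ->; rewrite subrr.
Qed.

Definition ct v : 'rV[K]_m := map_mx (mcoeff 0%MM) v.

Definition lift_ct (r : 'rV[K]_m) : 'rV[S]_m := map_mx (@mpolyC n K) r.

Lemma lift_ctK r : ct (lift_ct r) = r.
Proof. by apply/rowP => k; rewrite !mxE mcoeffC eqxx mulr1. Qed.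

Lemma ctB u v : ct (u - v) = ct u - ct v.
Proof. by apply/rowP => k; rewrite !mxE raddfB. Qed.

Definition deg_row d (r : 'rV[K]_m) := forall k, r 0 k != 0 -> sh k = d.

Lemma deg_row_ct d v : fhom d.+1 v -> deg_row d (ct v).
Proof.
move=> h k; rewrite !mxE; have := h k; case: (leqP (sh k) d) => kd.
  rewrite subSn //= => hk; apply: contraNeq => ne; apply/eqP.
  apply: dhomog_nemf_coeff hk _; rewrite /= mdeg0 eq_sym subn_eq0.
  by apply: contra ne => dk; rewrite eqn_leq kd.
by rewrite (eqP (_ : d.+1 - sh k == 0)%N) ?subn_eq0 //= => ->; rewrite mcoeff0 eqxx.
Qed.

Lemma fhom_lift_ct d r : deg_row d r -> fhom d.+1 (lift_ct r).
Proof.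
move=> h k; rewrite !mxE; case: (eqVneq (r 0 k) 0) => [->|/h ->].
  by rewrite mpolyC0; apply: phom0.
rewrite subSn // subnn /=.
by rewrite -alg_mpolyC; apply/dhomogZ/dhomog1.
Qed.

Lemma ct0_decomp d v : fhom d.+1 v -> ct v = 0 ->
  exists f : 'I_n -> 'rV[S]_m, (forall k, fhom d (f k)) /\ v = \sum_k 'X_k *: f k.
Proof.
move=> hv cv.
have [a ha] : exists a : 'I_m -> 'I_n -> S, forall l, v 0 l = \sum_k 'X_k * a l k.
  apply: (@fun_choice _ _ (fun l a => v 0 l = \sum_k 'X_k * a k)) => l.
  by apply: max_ideal_decomp; have /rowP /(_ l) := cv; rewrite !mxE.
exists (fun k => \row_l pproj (d - sh l) (a l k)); split.
  by move=> k l; rewrite mxE; apply: phom_pproj.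
apply/rowP => l; rewrite summxE.
under eq_bigr => k _ do rewrite !mxE.
have := hv l; case: (leqP (sh l) d) => ld.
  rewrite subSn // => /pproj_id <-; rewrite ha /= linear_sum /=; apply: eq_bigr => k _.
  have := pprojM (d - sh l) (a l k) (homog_X K k); rewrite addn1 /= => ->.
  by [].
rewrite (eqP (_ : d.+1 - sh l == 0)%N) ?subn_eq0 //= => ->.
rewrite big1 // => k _.
by rewrite (eqP (_ : d - sh l == 0)%N) ?mulr0 // subn_eq0 ltnW.
Qed.

Definition onechain (f : 'I_n -> 'rV[S]_m) (X : {set 'I_n}) : 'rV[S]_m :=
  if [pick k | X == [set k]] is Some k then f k else 0.

Lemma onechain1 f k : onechain f [set k] = f k.
Proof.
rewrite /onechain; case: pickP => [l /eqP/setP/(_ l)|/(_ k)]; last by rewrite eqxx.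
by rewrite !inE eqxx => /eqP->.
Qed.

Lemma kdiff_onechain (c : {set 'I_n} -> 'rV[S]_m) : 
  kdiff c set0 = \sum_k 'X_k *: c [set k].
Proof.
rewrite /kdiff; apply: eq_big => k; rewrite ?inE // => _.
rewrite setU0 /ksign; have -> : [set l : 'I_n in set0 | (l < k)%N] = set0.
  by apply/setP => l; rewrite !inE.
by rewrite cards0 expr0 mul1r.
Qed.

Lemma chain_onechain A d f : is_submod A -> (forall k, A (f k)) -> (forall k, fhom d (f k)) ->
  chain_in free_grading A 1 d (onechain f).
Proof.
move=> sA Af hf; split=> X; rewrite /onechain; case: pickP => [k /eqP Xk|_] //.
- by rewrite Xk cards1.
- exact: submod0.
- exact: hf.
exact: fhom0.
Qed.

End FreeModule.

Lemma zero_submod (R : pzRingType) (U : lmodType R) : is_submod (fun u : U => u = 0).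
Proof. by split=> // a u v -> ->; rewrite scaler0 add0r. Qed.

(** * Images and kernels of graded matrices, and dimension shifting *)

Section GradedMap.
Variables (K : fieldType) (n m m' : nat) (sh : 'I_m -> nat) (sh' : 'I_m' -> nat).
Local Notation S := {mpoly K[n]}.
Variable D : 'M[S]_(m', m).
Hypothesis D_hom : forall k l, if (sh l <= sh' k)%N
  then D k l \is (sh' k - sh l)%N.-homog else D k l == 0.

Lemma pproj_entry d k l f : pproj (d - sh l) (f * D k l) = pproj (d - sh' k) f * D k l.
Proof.
have := D_hom k l; case: ifP => [kl hD|_ /eqP ->]; last by rewrite !mulr0 pproj0.
rewrite ![_ * D k l]mulrC; case: (leqP (sh' k) d) => kd.
  by rewrite -(pprojM _ _ hD); congr (pproj _ _); lia.
rewrite (pprojM_le _ hD); last by lia.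
by rewrite (_ : (d - sh' k)%N = 0%N) ?mulr0 //; lia.
Qed.

Lemma fprojM d (w : 'rV[S]_m') : fproj sh d (w *m D) = fproj sh' d w *m D.
Proof.
apply/rowP => l; rewrite !mxE.
have -> : pproj (d - sh l) (\sum_k w 0 k * D k l) = \sum_k pproj (d - sh l) (w 0 k * D k l).
  by elim/big_rec2: _ => [|k x y _ <-]; rewrite ?pproj0 ?pprojD.
by apply: eq_bigr => k _; rewrite pproj_entry mxE.
Qed.

Lemma fhomM d (w : 'rV[S]_m') : fhom sh' d w -> fhom sh d (w *m D).
Proof. by move=> /fproj_id <-; rewrite -fprojM; apply: fhom_fproj. Qed.

Lemma ctM (w : 'rV[S]_m') : ct (w *m D) = ct w *m map_mx (mcoeff 0%MM) D.
Proof. by rewrite /ct map_mxM. Qed.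

Lemma deg_rowM d (r : 'rV[K]_m') : deg_row sh' d r -> deg_row sh d (r *m map_mx (mcoeff 0%MM) D).
Proof.
by move=> hr; rewrite -[r](lift_ctK n) -ctM; apply/deg_row_ct/fhomM/fhom_lift_ct.
Qed.

Section Quotient.
Variables (Z : 'rV[S]_m -> Prop).
Hypothesis ZE : forall v, Z v <-> exists w, v = w *m D.

Lemma image_submod : is_submod Z.
Proof.
split=> [|a u v /ZE[w ->] /ZE[w' ->]]; first by apply/ZE; exists 0; rewrite mul0mx.
by apply/ZE; exists (a *: w + w'); rewrite mulmxDl -scalemxAl.
Qed.

Lemma kernel_submod : is_submod (fun w : 'rV[S]_m' => w *m D = 0).
Proof.
by split=> [|a u v hu hv]; rewrite ?mul0mx // mulmxDl -scalemxAl hu hv scaler0 add0r.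
Qed.

Lemma image_lift d v : Z v -> fhom sh d v -> exists2 w, fhom sh' d w & v = w *m D.
Proof.
move=> /ZE[w ->] /fproj_id <-; exists (fproj sh' d w); last by rewrite fprojM.
exact: fhom_fproj.
Qed.

Lemma tor_kernel i j :
  tor_nz (free_grading K n sh') (fun=> True) (fun w => w *m D = 0) i j <->
  tor_nz (free_grading K n sh) Z (fun v => v = 0) i j.
Proof.
rewrite -[X in _ <-> tor_nz _ _ _ _ X]addn0.
apply: (@tor_nz_transfer _ _ _ _ (free_grading K n sh') (free_grading K n sh) (fun w => w *m D) 0) => //.
- by split=> // a u v -> ->; rewrite scaler0 add0r.
- by move=> a u v; rewrite mulmxDl -scalemxAl.
- by move=> d u hu; rewrite addn0; apply: fhomM.
- by move=> u _; apply/ZE; exists u.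
move=> d v Zv; rewrite addn0 => hv; have [w hw ->] := image_lift Zv hv.
by exists w; rewrite subrr.
Qed.

Let Z0 u : u = 0 -> Z u. Proof. by move=> ->; apply: (submod0 image_submod). Qed.

Let sT : is_submod (fun _ : 'rV[S]_m => True). Proof. by []. Qed.

Let sub_conn := tor_nz_conn (G := free_grading K n sh) image_submod (@zero_submod _ _) sT Z0 (fun _ _ => I).
Let sub_sub := tor_nz_sub (G := free_grading K n sh) image_submod sT Z0 (fun _ _ => I).

(** Dimension shifting: Z is F'/ker D, and the free module F contributes no Tor in positive
    homological degree, so the connecting map is an isomorphism there. It keeps the internal degree,
    hence the change of row. *)
Lemma tor_syzygy i j :
  tor_nz (free_grading K n sh) (fun=> True) Z i.+2 j <->
  tor_nz (free_grading K n sh') (fun=> True) (fun w => w *m D = 0) i.+1 j.+1.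
Proof.
rewrite tor_kernel; split=> h.
  by have [/tor_free_module[]//|[i' [[<-]]]] := sub_conn h.
by have [/tor_free_module[]//|[j' [[<-]]]] := sub_sub h.
Qed.

(** Boundedness of the rows passes to the next syzygy module, which lets the construction of a
    resolution continue. *)
Lemma tor_kernel_bound B : 
  (forall i j, tor_nz (free_grading K n sh) (fun=> True) Z i j -> (j <= B)%N) ->
  exists B', forall i j,
  tor_nz (free_grading K n sh') (fun=> True) (fun w => w *m D = 0) i j -> (j <= B')%N.
Proof.
move=> hB; exists (maxn B.+1 (\max_k sh k)) => i j; rewrite tor_kernel => h.
have [/tor_free_module[_ [k ->]]|[j' [-> /hB]]] := sub_sub h.
  by rewrite leq_max (leq_bigmax k) orbT.
by rewrite leq_max ltnS => ->.
Qed.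

End Quotient.
End GradedMap.

(** * Tor_0 and Tor_1 from the constant parts of the matrices *)

Section Minimal.
Variables (K : fieldType) (n m m' m'' : nat).
Variables (sh : 'I_m -> nat) (sh' : 'I_m' -> nat) (sh'' : 'I_m'' -> nat).
Local Notation S := {mpoly K[n]}.
Local Notation cst := (map_mx (mcoeff 0%MM)).
Variables (D : 'M[S]_(m', m)) (D' : 'M[S]_(m'', m')) (Z : 'rV[S]_m -> Prop).
Hypothesis D_hom : forall k l, if (sh l <= sh' k)%N
  then D k l \is (sh' k - sh l)%N.-homog else D k l == 0.
Hypothesis D'_hom : forall k l, if (sh' l <= sh'' k)%N
  then D' k l \is (sh'' k - sh' l)%N.-homog else D' k l == 0.
Hypothesis ZE : forall v, Z v <-> exists w, v = w *m D.
Hypothesis exact_D : forall w : 'rV_m', w *m D = 0 <-> exists u, w = u *m D'.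

Local Notation T := (tor_nz (free_grading K n sh) (fun=> True) Z).

Lemma ct_kdiff (c : {set 'I_n} -> 'rV[S]_m) X : ct (kdiff c X) = 0.
Proof.
apply/rowP => l; rewrite !mxE kdiff_coord /kdiff raddf_sum big1 //= => k _.
rewrite -[_ *: _]/(ksign K X k * 'X_k * c (k |: X) 0 l) !rmorphM /= mcoeffX.
by rewrite mnm1_eq0 mulr0 mul0r.
Qed.

Lemma ct_sumX (f : 'I_n -> 'rV[S]_m') : ct (\sum_k 'X_k *: f k) = 0.
Proof.
apply/rowP => l; rewrite !mxE summxE raddf_sum big1 //= => k _.
by rewrite mxE rmorphM /= mcoeffX mnm1_eq0 mul0r.
Qed.

Let sZ : is_submod Z := image_submod ZE.

(** Koszul boundaries have no constant terms, and a homogeneous vector without constant terms is a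
    boundary; only the cokernel of the constant part of [D] remains. *)
Lemma tor0_min e : T 0 e <->
  exists2 r, deg_row sh e r & forall w, deg_row sh' e w -> r <> w *m cst D.
Proof.
split=> [[c [[c1 _ c3] dc nc]]|[r hr nr]].
  exists (ct (c set0)); first exact/deg_row_ct/c3.
  move=> w hw cw.
  have hW : fhom sh e.+1 (lift_ct n w *m D) by apply: (fhomM D_hom); apply: fhom_lift_ct.
  have [||f [hf fE]] := @ct0_decomp _ _ _ sh e (c set0 - lift_ct n w *m D).
  - by apply: fhomB => //; apply: c3.
  - by rewrite ctB cw ctM lift_ctK subrr.
  have hch := chain_onechain (A := fun=> True) (sh := sh) (d := e) (f := f).
  apply: (nc (onechain f)); first exact: hch.
  move=> X; case: (eqVneq X set0) => [->|X0].
    rewrite kdiff_onechain; under eq_bigr => k _ do rewrite onechain1.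
    by rewrite -fE opprB addrCA subrr addr0; apply/ZE; exists (lift_ct n w).
  rewrite c1 ?cards_eq0 // (@kchain_kdiff _ _ _ 0) ?cards_eq0 ?subr0; first exact: submod0.
    by case: (hch) => //.
  by [].
exists (fun X => if X == set0 then lift_ct n r else 0); split.
- split=> // X; first by rewrite cards_eq0 => /negbTE->.
  by case: ifP => _; [apply: fhom_lift_ct|apply: fhom0].
- move=> X; rewrite kchain0_kdiff; first exact: submod0.
  by move=> Y; rewrite cards_eq0 => /negbTE->.
move=> f [f1 _ f3] /(_ set0); rewrite eqxx => hf.
have [|w hw wE] := image_lift D_hom ZE hf (d := e.+1).
  apply: fhomB; first exact: fhom_lift_ct.
  exact: (ghom_kdiff (G := free_grading K n sh)).
apply: (nr (ct w)); first exact: deg_row_ct.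
by rewrite -ctM -wE ctB lift_ctK ct_kdiff subr0.
Qed.

(** The symmetry of Tor in homological degree 1: the identity w D = sum_k X_k f_k matches a Koszul
    1-cycle f modulo Z with the constant part of [w], a cycle of the tensored complex. Higher
    degrees are brought to this case by [tor_syzygy]. *)
Lemma tor1_min e : T 1 e <->
  exists2 r, deg_row sh' e.+1 r /\ r *m cst D = 0
    & forall w, deg_row sh'' e.+1 w -> r <> w *m cst D'.
Proof.
split=> [[c [[c1 _ c3] dc nc]]|[r [hr rD] nr]].
  have hz : fhom sh e.+2 (kdiff c set0).
    exact: (ghom_kdiff (G := free_grading K n sh)).
  have [w hw wE] := image_lift D_hom ZE (dc set0) hz.
  exists (ct w); first split; first exact: deg_row_ct.
    by rewrite -ctM -wE ct_kdiff.
  move=> w' hw' cw.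
  have hW : fhom sh' e.+2 (lift_ct n w' *m D').
    by apply: (fhomM D'_hom); apply: fhom_lift_ct.
  have [||f [hf fE]] := @ct0_decomp _ _ _ sh' e.+1 (w - lift_ct n w' *m D').
  - exact: fhomB.
  - by rewrite ctB cw ctM lift_ctK subrr.
  (* Subtracting this chain, whose coefficients are in Z, leaves a cycle over the free module
     itself, since D' D = 0; it is a boundary because free modules have no Tor_1. *)
  pose fD k := f k *m D.
  have hfD := chain_onechain (sh := sh) (d := e.+1) (f := fD) sZ.
  have {}hfD : chain_in (free_grading K n sh) Z 1 e.+1 (onechain fD).
    by apply: hfD => k; [apply/ZE; exists (f k) | apply: (fhomM D_hom)].
  have sT : is_submod (fun _ : 'rV[S]_m => True) by [].
  have hc' : chain_in (free_grading K n sh) (fun=> True) 1 e.+1 (fun X => c X - onechain fD X).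
    by apply: chain_inB => //; apply: chain_in_sub hfD.
  have nT : ~ tor_nz (free_grading K n sh) (fun=> True) (fun v => v = 0) 1 e.
    by case/tor_free_module.
  have [|g [hg gE]] := kdiff_boundary nT hc'.
    move=> X; case: (eqVneq X set0) => [->|X0]; last first.
      by rewrite (@kchain_kdiff _ _ _ 0) ?cards_eq0 //; case: hc'.
    rewrite kdiffB wE kdiff_onechain.
    under eq_bigr => k _ do rewrite onechain1 /fD scalemxAl.
    rewrite -mulmx_suml -fE mulmxBl opprB addrCA subrr addr0.
    by apply/exact_D; exists (lift_ct n w').
  apply: (nc _ hg) => X; have := gE X.
  move/eqP; rewrite addrAC subr_eq0 => /eqP->.
  by case: hfD.
pose w := lift_ct n r.
have hw : fhom sh' e.+2 w by apply: fhom_lift_ct.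
have [||f [hf fE]] := @ct0_decomp _ _ _ sh e.+1 (w *m D).
- exact: (fhomM D_hom).
- by rewrite ctM lift_ctK.
have hch : chain_in (free_grading K n sh) (fun=> True) 1 e.+1 (onechain f).
  exact: chain_onechain.
exists (onechain f); split=> //.
  move=> X; case: (eqVneq X set0) => [->|X0].
    rewrite kdiff_onechain; under eq_bigr => k _ do rewrite onechain1.
    by rewrite -fE; apply/ZE; exists w.
  by rewrite (@kchain_kdiff _ _ _ 0) ?cards_eq0 //; [apply: submod0|case: hch].
move=> g [g1 _ g3] hg.
have [a ha] : exists a : 'I_n -> 'rV[S]_m',
    forall k, fhom sh' e.+1 (a k) /\ f k - kdiff g [set k] = a k *m D.
  apply: (@fun_choice _ _ (fun k a => fhom sh' e.+1 a /\ f k - kdiff g [set k] = a *m D)) => k.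
  have := hg [set k]; rewrite onechain1 => /(image_lift D_hom ZE (d := e.+1)) [|u hu uE]; last by exists u.
  by apply: fhomB => //; apply: (ghom_kdiff (G := free_grading K n sh)).
(* The boundary of [kdiff g] vanishes, so only the [a k] survive. Then w - sum_k X_k a_k is in the
   kernel of D, hence in the image of D', and it has the same constant part [r] as [w]. *)
have zE : w *m D = (\sum_k 'X_k *: a k) *m D.
  rewrite mulmx_suml; under [RHS]eq_bigr => k _ do rewrite -scalemxAl -(proj2 (ha k)) scalerBr.
  rewrite sumrB -fE -[X in _ = _ - X]kdiff_onechain kdiff_kdiff subr0.
  by [].
have hwa : fhom sh' e.+2 (w - \sum_k 'X_k *: a k).
  apply: fhomB => //; apply: (ghom_sum (G := free_grading K n sh')) => k _.
  by apply: fhomX; case: (ha k).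
have [|u hu uE] := image_lift D'_hom exact_D _ hwa; first by rewrite mulmxBl zE subrr.
apply: (nr (ct u)); first exact: deg_row_ct.
by rewrite -ctM -uE ctB lift_ctK ct_sumX subr0.
Qed.

End Minimal.

Lemma rank_sub_neq0 (K : fieldType) (p q m : nat) (A : 'M[K]_(p, m)) (B : 'M[K]_(q, m)) :
  (B <= A)%MS -> (\rank A - \rank B)%N <> 0%N <->
  exists2 r : 'rV_m, (r <= A)%MS & ~ (r <= B)%MS.
Proof.
move=> BA; split=> [/eqP|[r rA rB]].
  rewrite -lt0n subn_gt0 => lt; apply: NNPP => h.
  move: lt; rewrite ltnNge mxrankS //; apply/row_subP => i.
  by apply: NNPP => hi; apply: h; exists (row i A); rewrite ?row_sub.
apply/eqP; rewrite -lt0n subn_gt0 ltn_neqAle mxrankS // andbT.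
rewrite (mxrank_leqif_sup BA); apply/negP => AB; apply: rB.
exact: submx_trans AB.
Qed.

(** * Homology of a tensored resolution as Koszul homology *)

Section Link.
Variables (K : fieldType) (n : nat) (I : {mpoly K[n]} -> Prop) (F : free_complex K n).
Local Notation S := {mpoly K[n]}.
Hypotheses (sI : @is_submod _ S^o I) (gI : is_graded I).
Hypothesis res : graded_free_resolution I F.

Let fdiff_hom i (k : 'I_(frank F i.+1)) (l : 'I_(frank F i)) : if (fshift l <= fshift k)%N
  then fdiff F i k l \is (fshift k - fshift l)%N.-homog else fdiff F i k l == 0.
Proof. by case: res => -[h _] _ _ _; apply: h. Qed.

Let no_shift (l : 'I_1) : nat := 0%N.

Let faug_hom k (l : 'I_1) : if (no_shift l <= fshift k)%N
  then faug F k l \is (fshift k - no_shift l)%N.-homog else faug F k l == 0.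
Proof. by case: res => -[_ h] _ _ _; rewrite ord1 /no_shift subn0; apply: h. Qed.

Definition syz p : 'rV[S]_(frank F p) -> Prop :=
  match p with
  | 0 => fun v => I ((v *m faug F) 0 0)
  | q.+1 => fun v => v *m fdiff F q = 0
  end.

Let syzE p v : syz v <-> exists w, v = w *m fdiff F p.
Proof. by case: res => _ _ h0 h1; case: p v => [|p] v; [apply: h0|apply: h1]. Qed.

Local Notation TI := (tor_nz (poly_grading K n) (fun=> True) I).
Local Notation TF p := (tor_nz (free_grading K n (@fshift _ _ F p)) (fun=> True) (@syz p)).

Let tor_aug i j : TI i j <-> TF 0 i j.
Proof.
symmetry; rewrite -[X in _ <-> tor_nz _ _ _ _ X]addn0.
apply: (@tor_nz_transfer _ _ _ _ (free_grading K n (@fshift _ _ F 0)) (poly_grading K n)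
  (fun v => (v *m faug F) 0 0 : S^o) 0) => //.
- by move=> a u v; rewrite mulmxDl -scalemxAl !mxE.
- by move=> d u /(fhomM (sh := no_shift) (sh' := @fshift _ _ F 0) (D := faug F) faug_hom)/(_ 0); rewrite /no_shift subn0 addn0.
move=> d v _; rewrite addn0 => hv; case: res => _ /(_ v)[w hw] _ _.
exists (fproj (@fshift _ _ F 0) d w); split=> //; first exact: fhom_fproj.
rewrite -(fprojM (sh := no_shift) (sh' := @fshift _ _ F 0) (D := faug F) faug_hom) mxE /no_shift subn0 -[v](pproj_id hv) -pprojB.
exact: gI.
Qed.

Let tor_step p i j : TF p i.+2 j <-> TF p.+1 i.+1 j.+1.
Proof. exact: (tor_syzygy (@fdiff_hom p) (@syzE p)). Qed.

Let tor_iter p i j : TF 0 (p + i)%N.+1 j <-> TF p i.+1 (p + j)%N.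
Proof.
elim: p i j => [|p IH] i j; first by rewrite !add0n.
by rewrite addSnnS IH tor_step addSn.
Qed.

Let sub_tensor_degree i d (r : 'rV_(frank F i)) :
  (r <= tensor_degree F i d)%MS <-> deg_row (@fshift _ _ F i) d r.
Proof.
rewrite /tensor_degree; split=> [/submxP[u ->] k|hr].
  rewrite mul_mx_diag !mxE; by case: (eqVneq (fshift k) d) => // _; rewrite /= mulr0 eqxx.
apply/submxP; exists r; apply/rowP => k; rewrite mul_mx_diag !mxE.
by case: (eqVneq (r 0 k) 0) => [->|/hr ->]; rewrite ?mul0r // eqxx /= mulr1.
Qed.

Let sub_tensor_boundaries i d (r : 'rV_(frank F i)) :
  (r <= tensor_boundaries F i d)%MS <->
  exists2 w, deg_row (@fshift _ _ F i.+1) d w & r = w *m tensor_diff F i.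
Proof.
rewrite /tensor_boundaries; split=> [/submxP[u ->]|[w /sub_tensor_degree/submxP[u ->] ->]].
  by exists (u *m tensor_degree F i.+1 d); rewrite ?mulmxA // -sub_tensor_degree submxMl.
by rewrite -mulmxA submxMl.
Qed.

Let sub_tensor_cycles i d (r : 'rV_(frank F i.+1)) :
  (r <= tensor_cycles F i.+1 d)%MS <->
  deg_row (@fshift _ _ F i.+1) d r /\ r *m tensor_diff F i = 0.
Proof.
rewrite /= sub_capmx; split=> [/andP[/sub_tensor_degree h /sub_kermxP]|[h1 h2]]; first by [].
by apply/andP; split; [apply/sub_tensor_degree|apply/sub_kermxP].
Qed.

Let tensor_diff_diff i : tensor_diff F i.+1 *m tensor_diff F i = 0.
Proof.
rewrite /tensor_diff -map_mxM.
suff -> : fdiff F i.+1 *m fdiff F i = 0 by apply: raddf0.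
apply/row_matrixP => k; rewrite row_mul row0; case: res => _ _ _ h.
by apply/h; exists (delta_mx 0 k); rewrite rowE.
Qed.

Let boundaries_cycles i d : (tensor_boundaries F i d <= tensor_cycles F i d)%MS.
Proof.
apply/rV_subP => r /sub_tensor_boundaries[w hw ->].
have hd : deg_row (@fshift _ _ F i) d (w *m tensor_diff F i).
  exact: (deg_rowM (@fdiff_hom i)).
case: i {r} w hw hd => [|i] w hw hd; first by apply/sub_tensor_degree.
by apply/sub_tensor_cycles; split=> //; rewrite -mulmxA tensor_diff_diff mulmx0.
Qed.

(** Dimension shifting turns Tor_{i+1} of S/I into Tor_1 of [F_i] modulo its syzygies, where
    [tor1_min] reads it off three consecutive free modules; i = 0 is [tor0_min]. *)
Lemma tensor_homology_tor i j : tensor_homology_dim F i (i + j) <> 0%N <-> TI i j.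
Proof.
rewrite /tensor_homology_dim (rank_sub_neq0 (@boundaries_cycles _ _)) tor_aug.
case: i => [|i].
  rewrite (tor0_min (@fdiff_hom 0) (@syzE 0)); split=> -[r hr nr]; exists r.
  - exact/sub_tensor_degree.
  - by move=> w hw rE; apply: nr; apply/sub_tensor_boundaries; exists w.
  - exact/sub_tensor_degree.
  - by move=> /sub_tensor_boundaries[w hw rE]; apply: (nr w).
have -> : TF 0 i.+1 j <-> TF i 1 (i + j)%N by rewrite -tor_iter addn0.
rewrite (tor1_min (@fdiff_hom i) (@fdiff_hom i.+1) (@syzE i) (@syzE i.+1)).
split=> -[r hr nr]; exists r.
- exact/sub_tensor_cycles.
- by move=> w hw rE; apply: nr; apply/sub_tensor_boundaries; exists w.
- exact/sub_tensor_cycles.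
- by move=> /sub_tensor_boundaries[w hw rE]; apply: (nr w).
Qed.

End Link.

(** A vector of Q outside the row space raises the rank when it is appended, and the rank is at most
    N. *)
Lemma subspace_generators (K : fieldType) N (Q : 'rV[K]_N -> Prop) : is_submod Q ->
  exists M (A : 'M_(M, N)), (forall i, Q (row i A)) /\ forall r, Q r -> (r <= A)%MS.
Proof.
move=> sQ; suff ext d M (A : 'M_(M, N)) : (forall i, Q (row i A)) -> (N - \rank A < d)%N ->
    exists M (A : 'M_(M, N)), (forall i, Q (row i A)) /\ forall r, Q r -> (r <= A)%MS.
  by apply: (ext N.+1 0%N 0) => [[]//|]; rewrite mxrank0 subn0.
elim: d M A => // d IH M A QA hd.
case: (classic (forall r, Q r -> (r <= A)%MS)) => [h|h].
  by exists M, A.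
have [r hr] := not_all_ex_not _ _ h; have [Qr /negP rA] := imply_to_and _ _ hr.
apply: (IH _ (col_mx A r)) => [i|].
  by case: (split_ordP i) => k ->; rewrite ?rowKu ?rowKd // (row_id k).
have lt : (\rank A < \rank (col_mx A r))%N.
  have Ac : (A <= col_mx A r)%MS by rewrite -addsmxE addsmxSl.
  rewrite ltn_neqAle mxrankS // andbT (mxrank_leqif_sup Ac).
  by apply: contra rA; apply: submx_trans; rewrite -addsmxE addsmxSr.
have := rank_leq_col (col_mx A r); lia.
Qed.

(** * Finite generation from a bound on the rows of Tor *)

Section Cover.
Variables (K : fieldType) (n m : nat) (sh : 'I_m -> nat).
Local Notation S := {mpoly K[n]}.
Variable Z : 'rV[S]_m -> Prop.
Hypothesis sZ : is_submod Z.

(** An element of degree e has coordinates supported on the finitely many monomials of degree at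
    most e, so linear algebra over K applies to its coefficients. *)
Lemma degree_generators e : exists M (D : 'M[S]_(M, m)),
  (forall k, Z (row k D) /\ fhom sh e.+1 (row k D)) /\
  forall z, Z z -> fhom sh e.+1 z -> exists w, z = w *m D.
Proof.
pose T := ('I_m * 'X_{1..n < e.+1})%type.
pose u (t : T) : 'rV[S]_m := 'X_[bmnm t.2] *: delta_mx 0 t.1.
pose comb (r : 'rV[K]_#|{: T}|) := \sum_i (r 0 i)%:MP *: u (enum_val i).
have comb_lin a r r' : comb (a *: r + r') = a%:MP *: comb r + comb r'.
  rewrite /comb scaler_sumr -big_split; apply: eq_bigr => i _.
  by rewrite /= !mxE mpolyCD mpolyCM scalerDl scalerA.
have comb0 : comb 0 = 0.
  by rewrite /comb big1 // => i _; rewrite mxE mpolyC0 scale0r.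
have homC a d v : fhom sh d v -> fhom sh d (a%:MP *: v).
  move=> hv k; rewrite mxE -[X in phom X]addn0; apply: phomM => //.
  by rewrite -alg_mpolyC; apply/dhomogZ/dhomog1.
pose Q r := Z (comb r) /\ fhom sh e.+1 (comb r).
have sQ : is_submod Q.
  split=> [|a r r' [Zr hr] [Zr' hr']]; first by rewrite /Q comb0; split; [apply: submod0|apply: fhom0].
  rewrite /Q comb_lin; split; first by apply: submodD => //; apply: submodZ.
  by apply: (ghomD (G := free_grading K n sh)) => //; apply: homC.
have [M [A [QA hA]]] := subspace_generators sQ.
exists M, (\matrix_(i < M) comb (row i A)); split; first by move=> k; rewrite rowK; apply: QA.
move=> z Zz hz.
pose coef (t : T) := (z 0 t.1)@_(bmnm t.2).
pose r : 'rV[K]_#|{: T}| := \row_i coef (enum_val i).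
have zE : z = comb r.
  rewrite /comb (reindex (@enum_rank T)) /=; last exact/onW_bij/enum_rank_bij.
  under eq_bigr => t _ do rewrite mxE enum_rankK.
  apply/rowP => l; rewrite -(pair_bigA _ (fun k (m0 : 'X_{1..n < e.+1}) => ((z 0 k)@_(bmnm m0))%:MP *: ('X_[bmnm m0] *: delta_mx 0 k : 'rV[S]_m))) /= summxE (bigD1 l) //= [X in _ + X]big1 ?addr0.
    rewrite summxE; under eq_bigr => t _ do rewrite !mxE !eqxx mulr1 mul_mpolyC.
    apply: mpolywE; have := hz l; case: (leqP (sh l) e) => le.
      rewrite subSn //= => /dhomogP h; rewrite msizeE; apply/bigmax_leqP_seq => t /h /= ht _.
      by rewrite ht ltnS leq_subr.
    by rewrite (eqP (_ : e.+1 - sh l == 0)%N) ?subn_eq0 //= => ->; rewrite msize0.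
  move=> k kl; rewrite summxE big1 // => t _.
  by rewrite !mxE eqxx [l == k]eq_sym (negbTE kl) /= !mulr0.
have /submxP[w rE] : (r <= A)%MS by apply: hA; split; rewrite -zE.
exists (lift_ct n w); rewrite zE rE !mulmx_sum_row.
rewrite (_ : comb _ = \sum_i (w 0 i)%:MP *: comb (row i A)).
  by apply: eq_bigr => i _; rewrite rowK mxE.
elim/big_rec2: _ => [|i x y _ <-]; first exact: comb0.
by rewrite comb_lin.
Qed.

Lemma bounded_generators E : exists M (sh' : 'I_M -> nat) (D : 'M[S]_(M, m)),
  (forall k, Z (row k D) /\ fhom sh (sh' k).+1 (row k D)) /\
  forall e z, (e < E)%N -> Z z -> fhom sh e.+1 z -> exists w, z = w *m D.
Proof.
elim: E => [|E [M [sh' [D [D1 D2]]]]].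
  by exists 0%N, (fun=> 0%N), 0; split=> [[]|].
have [M' [D' [D1' D2']]] := degree_generators E.
exists (M + M')%N, (fun k => if split k is inl a then sh' a else E), (col_mx D D'); split.
  move=> k; case: (split_ordP k) => a ->.
    by rewrite rowKu.
  by rewrite rowKd.
move=> e z; rewrite ltnS leq_eqVlt => /orP[/eqP->|eE] Zz hz.
  have [w ->] := D2' z Zz hz; exists (row_mx 0 w).
  by rewrite mul_row_col mul0mx add0r.
have [w ->] := D2 e z eE Zz hz; exists (row_mx w 0).
by rewrite mul_row_col mul0mx addr0.
Qed.

Lemma fproj_sum (v : 'rV[S]_m) : exists N, v = \sum_(0 <= e < N) fproj sh e.+1 v.
Proof.
exists (\max_k sh k + \max_k msize (v 0%R k))%N; apply/rowP => l; rewrite summxE.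
set N := (_ + _)%N.
have shN : (sh l <= N)%N by rewrite /N; have := @leq_bigmax _ sh l; lia.
rewrite (big_cat_nat (leq0n _) shN) /= [X in X + _]big_nat_cond [X in X + _]big1 ?add0r; last first.
  move=> e /andP[/andP[_ el] _]; by rewrite mxE (_ : (e.+1 - sh l)%N = 0%N) //; lia.
rewrite -{1}[sh l]add0n big_addn big_mkord.
under eq_bigr => e _ do rewrite mxE -addSn addnK /=.
apply: pihomog_partitionE.
by rewrite /N; have := @leq_bigmax _ sh l; have := @leq_bigmax _ (fun k => msize (v 0 k)) l; lia.
Qed.

Hypothesis gZ : forall d v, Z v -> Z (fproj sh d v).
Hypothesis bZ : exists B, forall i j,
  tor_nz (free_grading K n sh) (fun=> True) Z i j -> (j <= B)%N.

(** The bound on Tor takes the place of Hilbert's basis theorem: Tor_0 of Z, which is governed by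
    the shifts of F and by Tor_1 of F/Z, vanishes above some degree E, so Z has no new generators
    beyond it. *)
Lemma graded_cover : exists M (sh' : 'I_M -> nat) (D : 'M[S]_(M, m)),
  (forall k l, if (sh l <= sh' k)%N then D k l \is (sh' k - sh l)%N.-homog else D k l == 0)
  /\ forall v, Z v <-> exists w, v = w *m D.
Proof.
have [B hB] := bZ.
have Z0 u : u = 0 -> Z u by move=> ->; apply: submod0.
have sT : is_submod (fun _ : 'rV[S]_m => True) by [].
have tor0 e : tor_nz (free_grading K n sh) Z (fun v => v = 0) 0 e -> (e <= maxn B.+1 (\max_k sh k))%N.
  move=> h; have [|] := tor_nz_sub (G := free_grading K n sh) sZ sT Z0 (fun _ _ => I) h.
    by case/tor_free_module => _ [k ->]; rewrite leq_max (leq_bigmax k) orbT.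
  by case=> j' [-> /hB]; rewrite leq_max ltnS => ->.
set E := maxn _ _ in tor0.
have [M [sh' [D [D1 D2]]]] := bounded_generators E.+1.
exists M, sh', D; split.
  move=> k l; have [_ /(_ l)] := D1 k; rewrite mxE; case: leqP => lk.
    by rewrite subSn.
  by rewrite (eqP (_ : (sh' k).+1 - sh l == 0)%N) ?subn_eq0 //= => ->.
have DZ w : Z (w *m D).
  rewrite mulmx_sum_row; apply: submod_sum => // k _; apply: submodZ => //.
  by case: (D1 k).
have imD (I : Type) (r : seq I) (P : pred I) (G : I -> 'rV[S]_m) :
    (forall i, P i -> exists w, G i = w *m D) -> exists w, \sum_(i <- r | P i) G i = w *m D.
  move=> h; apply: (big_ind (fun v => exists w, v = w *m D)) => //; first by exists 0; rewrite mul0mx.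
  by move=> _ _ [w ->] [w' ->]; exists (w + w'); rewrite mulmxDl.
have D3 e z : Z z -> fhom sh e.+1 z -> exists w, z = w *m D.
  elim: e z => [|e IH] z Zz hz; first exact: (D2 0%N).
  case: (leqP e.+1 E) => eE; first exact: (D2 e.+1).
  have nT : ~ tor_nz (free_grading K n sh) Z (fun v => v = 0) 0 e.+1.
    by move=> /tor0; rewrite leqNgt eE.
  (* Above degree E the 0-chain [z] is a boundary, that is, z = sum_k X_k z_k with z_k in Z of one
     degree less, and induction applies to the z_k. *)
  pose c (X : {set 'I_n}) := if X == set0 then z else 0.
  have hc : kchain 0 c by move=> X; rewrite cards_eq0 /c => /negbTE->.
  have [|X|f [[_ f2 f3] /(_ set0)]] := kdiff_boundary (c := c) nT.
  - split=> // X; rewrite /c; case: ifP => // _; [exact: submod0|exact: fhom0].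
  - exact: kchain0_kdiff.
  rewrite /c eqxx => /eqP; rewrite subr_eq0 => /eqP ->.
  rewrite kdiff_onechain; apply: imD => k _.
  by have [w ->] := IH _ (f2 [set k]) (f3 [set k]); exists ('X_k *: w); rewrite scalemxAl.
move=> v; split=> [Zv|[w ->]]; last exact: DZ.
have [N ->] := fproj_sum v; apply: imD => e _.
by apply: (D3 e); [apply: gZ|apply: fhom_fproj].
Qed.

End Cover.

(** * Construction of a graded free resolution *)

Section Existence.
Variables (K : fieldType) (n : nat).
Local Notation S := {mpoly K[n]}.

(** One step of the recursion: a free module together with the submodule that the next differential
    has to cover. The bound on Tor is carried along because it guarantees that a finite cover
    exists. *)
Record stage := Stage {
  st_rank : nat;
  st_shift : 'I_st_rank -> nat;
  st_mod : 'rV[S]_st_rank -> Prop;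
  st_sub : is_submod st_mod;
  st_graded : forall d v, st_mod v -> st_mod (fproj st_shift d v);
  st_bounded : exists B, forall i j,
    tor_nz (free_grading K n st_shift) (fun=> True) st_mod i j -> (j <= B)%N
}.

Record cover (s : stage) := Cover {
  cv_rank : nat;
  cv_shift : 'I_cv_rank -> nat;
  cv_map : 'M[S]_(cv_rank, st_rank s);
  cv_hom : forall k l, if (st_shift l <= cv_shift k)%N
    then cv_map k l \is (cv_shift k - st_shift l)%N.-homog else cv_map k l == 0;
  cv_onto : forall v, st_mod v <-> exists w, v = w *m cv_map
}.

Lemma cover_exists s : exists c : cover s, True.
Proof.
have [M [sh' [D [D1 D2]]]] := graded_cover (@st_sub s) (@st_graded s) (@st_bounded s).
by exists (Cover D1 D2).
Qed.

Definition choose_cover s : cover s := proj1_sig (constructive_indefinite_description _ (cover_exists s)).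

Lemma kernel_graded s (c : cover s) d w :
  w *m cv_map c = 0 -> fproj (@cv_shift _ c) d w *m cv_map c = 0.
Proof.
move=> h; rewrite -(fprojM (@cv_hom _ c)) h; apply/rowP => k.
by rewrite !mxE pproj0.
Qed.

Definition next s : stage :=
  let c := choose_cover s in
  @Stage (cv_rank c) (@cv_shift _ c) (fun w => w *m cv_map c = 0) (kernel_submod (cv_map c))
    (@kernel_graded s c)
    (let: ex_intro B hB := @st_bounded s in tor_kernel_bound (@cv_hom _ c) (@cv_onto _ c) hB).

Fixpoint stages s i := if i is j.+1 then next (stages s j) else s.

Variable I : S -> Prop.
Hypotheses (sI : @is_submod _ S^o I) (gI : is_graded I).

Local Notation TI := (tor_nz (poly_grading K n) (fun=> True) I).

Hypothesis bI : exists B, forall i j, TI i j -> (j <= B)%N.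

Let Z0 (v : 'rV[S]_1) := I (v 0 0).

Let sZ0 : is_submod Z0.
Proof.
split=> [|a u v hu hv]; rewrite /Z0 !mxE; first exact: (submod0 sI).
exact: (proj2 sI).
Qed.

Let no_shift (k : 'I_1) := 0%N.

Let gZ0 d v : Z0 v -> Z0 (fproj no_shift d v).
Proof. by move=> h; rewrite /Z0 mxE subn0; apply: gI. Qed.

Let bZ0 : exists B, forall i j,
  tor_nz (free_grading K n no_shift) (fun=> True) Z0 i j -> (j <= B)%N.
Proof.
have [B hB] := bI; exists B => i j h; apply: (hB i).
have trf : tor_nz (free_grading K n no_shift) (fun=> True) Z0 i j <-> TI i (j + 0)%N.
  apply: (@tor_nz_transfer _ _ _ _ (free_grading K n no_shift) (poly_grading K n)
    (fun v => v 0 0 : S^o) 0) => //.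
  - by move=> a u v; rewrite !mxE.
  - by move=> d u /(_ 0); rewrite subn0 addn0.
  move=> d v _; rewrite addn0 => hv; exists (\row_k v); split=> //.
    by move=> k; rewrite mxE subn0.
  by rewrite mxE subrr; apply: (submod0 sI).
by rewrite -[j]addn0; apply/trf.
Qed.

Let s0 : stage := Stage sZ0 gZ0 bZ0.

Definition bounded_resolution : free_complex K n :=
  @FreeComplex K n (fun i => st_rank (stages s0 i)) (fun i => @st_shift (stages s0 i))
    (fun i => cv_map (choose_cover (stages s0 i))) 1%:M.

Lemma bounded_resolutionP : graded_free_resolution I bounded_resolution.
Proof.
split; first split.
- by move=> i k l; apply: (@cv_hom _ (choose_cover (stages s0 i))).
- by move=> k; rewrite !ord1 mxE eqxx; apply: dhomog1.
- by move=> f; exists (\row_k f); rewrite mulmx1 mxE subrr; apply: (submod0 sI).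
- by move=> v; rewrite mulmx1; apply: (@cv_onto s0).
by move=> i v; apply: (@cv_onto (stages s0 i.+1)).
Qed.

(** Existence makes [epsilon] return a genuine resolution, and every resolution computes the Koszul
    Tor. *)
Lemma betti_tor i j : betti I i (i + j) <> 0%N <-> TI i j.
Proof.
rewrite /betti; apply: tensor_homology_tor => //.
apply: epsilon_spec; exists bounded_resolution; exact: bounded_resolutionP.
Qed.

End Existence.

(** * Binomial edge ideals *)

Section EdgeIdeals.
Variables (K : fieldType) (V : finType).
Local Notation n := #|{: V + V}|.
Local Notation S := {mpoly K[n]}.
Local Notation x := (xvar K).
Local Notation y := (yvar K).
Local Notation edge := (edge_binomial K).
Implicit Types (E H : rel V) (u v w : V) (W : {set V}) (X : {set 'I_n}).

Definition xidx u : 'I_n := enum_rank (inl u).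
Definition yidx u : 'I_n := enum_rank (inr u).

Lemma eq_xidx u w : (xidx u == xidx w) = (u == w).
Proof. by rewrite (inj_eq enum_rank_inj). Qed.

Lemma eq_yidx u w : (yidx u == yidx w) = (u == w).
Proof. by rewrite (inj_eq enum_rank_inj). Qed.

Lemma neq_xyidx u w : (xidx u == yidx w) = false.
Proof. by rewrite (inj_eq enum_rank_inj). Qed.

Definition edges E f := exists u w, E u w /\ f = edge u w.

Definition edges_vars E X f := edges E f \/ vars X f.

Lemma binomial_edge_idealE E f : binomial_edge_ideal E f <-> idl (edges E) f.
Proof.
split=> [[c ->]|].
  apply: (submod_sum (idl_submod _)) => -[u w] /= Euw; apply/idlM/idl_gen.
  by exists u, w.
elim=> [|a g h [u [w [Euw ->]]] _ [c ->]].
  by exists (fun=> 0); rewrite big1 // => p _; rewrite mul0r.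
exists (fun p => (if p == (u, w) then a else 0) + c p).
rewrite [RHS](eq_bigr (fun p => (if p == (u, w) then a else 0) * edge p.1 p.2 + c p * edge p.1 p.2)); last first.
  by move=> p _; rewrite mulrDl.
rewrite big_split /=; congr (_ + _).
rewrite (bigD1 (u, w)) //= eqxx big1 ?addr0 // => p /andP[_ /negbTE->].
by rewrite mul0r.
Qed.

Lemma edge_homog u w : edge u w \is 2.-homog.
Proof. by apply: rpredB; apply: (@dhomogM _ _ _ 1 _ 1); apply: homog_X. Qed.

Lemma edges_homog E f : edges E f -> exists d, f \is d.-homog.
Proof. by case=> u [w [_ ->]]; exists 2; apply: edge_homog. Qed.

Lemma edges_vars_homog E X f : edges_vars E X f -> exists d, f \is d.-homog.
Proof. by case=> [/edges_homog //|]; apply: vars_homog. Qed.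

Lemma edgeC u w : edge w u = - edge u w.
Proof. by rewrite /edge_binomial opprB mulrC [x u * _]mulrC. Qed.

Lemma kill_edge X u w :
  xidx u \notin X -> yidx u \notin X -> xidx w \notin X -> yidx w \notin X ->
  kill X (edge u w) = edge u w.
Proof.
move=> h1 h2 h3 h4; rewrite /edge_binomial killB !killM !killX.
by rewrite (negbTE h1) (negbTE h2) (negbTE h3) (negbTE h4).
Qed.

Definition avoids E u := forall w w', E w w' -> w != u /\ w' != u.

Definition vidx u : {set 'I_n} := [set xidx u; yidx u].

Lemma kill_edge_avoid E u w w' X : avoids E u -> X \subset vidx u -> E w w' ->
  kill X (edge w w') = edge w w'.
Proof.
move=> Eu Xu /Eu[wu wu'].
by apply: kill_edge; apply: (contra (subsetP Xu _)); rewrite !inE ?eq_xidx ?eq_yidx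
  ?neq_xyidx ?[yidx _ == xidx _]eq_sym ?neq_xyidx ?orbF //.
Qed.

Lemma regular_edges_vars E X u k : avoids E u -> k \in vidx u -> k \notin X ->
  regular_mod (idl (edges_vars E X)) 'X_k.
Proof.
move=> Eu ku kX; apply: regular_X => f [[w [w' [Eww ->]]]|[l lX ->]].
  by apply: kill_edge_avoid Eu _ Eww; rewrite sub1set.
rewrite killX inE; case: eqP => // lk; by case/negP: kX; rewrite -lk.
Qed.

Lemma eq_edges_vars0 E f : idl (edges_vars E set0) f <-> idl (edges E) f.
Proof.
split; last by apply: idlW => g; left.
by apply: idlW => g [//|[k]]; rewrite inE.
Qed.

Lemma regular_edges E u k : avoids E u -> k \in vidx u -> regular_mod (idl (edges E)) 'X_k.
Proof.
move=> Eu ku f /eq_edges_vars0 h; apply/eq_edges_vars0.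
by apply: (regular_edges_vars Eu ku) h; rewrite inE.
Qed.

Lemma idl_edges_var E X k f : k \in X -> idl (edges_vars E X) ('X_k * f).
Proof. by move=> kX; apply/idlMr/idl_gen; right; exists k. Qed.

Lemma idl_edges_vidx E u w : idl (edges_vars E (vidx u)) (edge u w).
Proof.
rewrite /edge_binomial [x w * _]mulrC.
by apply: idlB; apply: idl_edges_var; rewrite !inE eqxx ?orbT.
Qed.

Lemma idl_edges_vidxC E u w : idl (edges_vars E (vidx u)) (edge w u).
Proof. by rewrite edgeC -mulN1r; apply/idlM/idl_edges_vidx. Qed.

Local Notation T P := (tor_nz (poly_grading K n) (fun=> True) (idl P)).

Lemma edges_vars_adj E X k f : adj (edges_vars E X) 'X_k f <-> edges_vars E (k |: X) f.
Proof.
split=> [[[h|[l lX ->]]|->]|[h|[l /setU1P [->|lX] ->]]]; try by [left; left | left].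
- by right; exists l => //; rewrite setU1r.
- by right; exists k => //; rewrite setU11.
- by right.
by left; right; exists l.
Qed.

Lemma idl_edges_vars_adj E X k f :
  idl (adj (edges_vars E X) 'X_k) f <-> idl (edges_vars E (k |: X)) f.
Proof. by split; apply: idlW => g /edges_vars_adj. Qed.

(** The two variables of an isolated vertex are regular one after the other, and each raises i by
    one without changing the row. *)
Lemma vidx_tor_le E u i j : avoids E u ->
  T (edges E) i j -> T (edges_vars E (vidx u)) i.+2 j.
Proof.
move=> Eu /(eq_tor_idl _ _ (eq_edges_vars0 E)) h.
have h1 : T (edges_vars E (yidx u |: set0)) i.+1 j.
  apply/(eq_tor_idl _ _ (idl_edges_vars_adj E _ _)).
  apply: tor_X_le h; first exact: edges_vars_homog.
  by apply: (regular_edges_vars Eu); rewrite !inE ?eqxx ?orbT.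
have := @tor_X_le _ _ (edges_vars E (yidx u |: set0)) (xidx u) _ _ _ _ h1.
rewrite (eq_tor_idl _ _ (idl_edges_vars_adj E _ _)) setU0; apply.
  exact: edges_vars_homog.
by apply: (regular_edges_vars Eu); rewrite !inE ?eqxx ?orbT ?neq_xyidx.
Qed.

Lemma vidx_tor_ge E u i j : avoids E u -> T (edges_vars E (vidx u)) i j ->
  exists i', T (edges E) i' j /\ (i <= i'.+2)%N.
Proof.
move=> Eu h.
have {h} : T (adj (edges_vars E (yidx u |: set0)) 'X_(xidx u)) i j.
  by rewrite (eq_tor_idl _ _ (idl_edges_vars_adj E _ _)) setU0.
case/tor_X_ge => [||h|[i1 -> h]].
- exact: edges_vars_homog.
- by apply: (regular_edges_vars Eu); rewrite !inE ?eqxx ?orbT ?neq_xyidx.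
all: move: h; rewrite -(eq_tor_idl _ _ (idl_edges_vars_adj E _ _)).
all: case/tor_X_ge => [||h|[i2 -> h]]; try exact: edges_vars_homog.
all: try by apply: (regular_edges_vars Eu); rewrite !inE ?eqxx ?orbT.
all: move: h; rewrite (eq_tor_idl _ _ (eq_edges_vars0 E)) => h.
all: by eexists; split; [exact: h|lia].
Qed.

(** Setting x_w = 0 turns the binomial into x_u y_w, a product of regular elements, so the part of f
    without x_w is in I. The rest is x_w a with a of lower degree; x_w is regular too, and induction
    on the degree applies to a. *)
Lemma regular_edge E u w : u != w -> avoids E u -> avoids E w ->
  regular_mod (idl (edges E)) (edge u w).
Proof.
move=> uw Eu Ew; set I := idl (edges E).
have gI : is_graded I by apply: idl_graded => f; apply: edges_homog.
have rx : regular_mod I (x u) by apply: (regular_edges Eu); rewrite !inE eqxx.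
have ry : regular_mod I (y w) by apply: (regular_edges Ew); rewrite !inE eqxx orbT.
have rw : regular_mod I (x w) by apply: (regular_edges Ew); rewrite !inE eqxx.
have key d f : phom d f -> I (edge u w * f) -> I f.
  elim: d f => [|d IH] f hf hI; first by rewrite (hf : f = 0); apply: Idl0.
  have k0 : I (kill [set xidx w] f).
    apply/ry/rx; rewrite mulrA.
    have := @kill_idl _ _ [set xidx w] (edges E) _ _ hI.
    rewrite killM /edge_binomial killB !killM !killX !inE eqxx mul0r subr0.
    rewrite ![_ == xidx w]eq_sym neq_xyidx eq_xidx eq_sym (negbTE uw); apply.
    move=> g [a [b [Eab ->]]]; rewrite (kill_edge_avoid Ew _ Eab).
      by apply: idl_gen; exists a, b.
    by apply/subsetP => k; rewrite !inE => ->.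
  have [a fE] := kill1_decomp (xidx w) f.
  have {}fE : f = pproj d.+1 (kill [set xidx w] f) + 'X_(xidx w) * pproj d a.
    rewrite -[LHS](pproj_id hf) {1}fE pprojD; congr (_ + _).
    by rewrite -[in LHS]addn1 pprojM //; apply: homog_X.
  rewrite fE; apply: idlAdd; first exact: gI.
  apply/idlM/IH; first exact: phom_pproj.
  apply: rw; move: hI; rewrite {1}fE mulrDr => h.
  have := idlB h (idlM (edge u w) (gI d.+1 _ k0)).
  by rewrite [_ + edge u w * _]addrC addrK mulrCA.
move=> f hf; rewrite (@pihomog_partitionE _ _ mdeg (msize f) f) //.
apply: (submod_sum (idl_submod _)) => d _; apply: (key d.+1); first exact: pihomogP.
by have := gI d.+3 _ hf; rewrite /= -[d.+2]/(2 + d)%N pihomogM //; apply: edge_homog.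
Qed.

Lemma edge_coef u w : let h l := (l == yidx w)%:R * x u - (l == yidx u)%:R * x w in
  (forall l, h l \is 1.-homog) /\ edge u w = \sum_l h l * 'X_l.
Proof.
split=> [l|].
  by apply: rpredB; case: eqP => _; rewrite ?mul1r ?mul0r ?dhomog0 //; apply: homog_X.
under eq_bigr => l _ do rewrite mulrBl.
rewrite sumrB /edge_binomial; congr (_ - _).
  rewrite (bigD1 (yidx w)) //= eqxx mul1r big1 ?addr0 // => l /negbTE->.
  by rewrite !mul0r.
rewrite (bigD1 (yidx u)) //= eqxx mul1r big1 ?addr0 // => l /negbTE->.
by rewrite !mul0r.
Qed.

Definition add_edge E u w : rel V := fun a b =>
  [|| E a b, (a == u) && (b == w) | (a == w) && (b == u)].

Lemma add_edge_adj E u w f :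
  idl (adj (edges E) (edge u w)) f <-> idl (edges (add_edge E u w)) f.
Proof.
split; apply: idl_sub => g.
  case=> [[a [b [Eab ->]]]|->]; apply: idl_gen.
    by exists a, b; rewrite /add_edge Eab.
  by exists u, w; rewrite /add_edge !eqxx orbT.
case=> a [b [/or3P[Eab|/andP[/eqP-> /eqP->]|/andP[/eqP-> /eqP->]] ->]].
- by apply: idl_gen; left; exists a, b.
- by apply: idl_gen; right.
rewrite (edgeC u w) -mulN1r; apply/idlM/idl_gen; by right.
Qed.

Lemma add_edge_tor_le E u w i j : u != w -> avoids E u -> avoids E w ->
  T (edges E) i j -> T (edges (add_edge E u w)) i.+1 j.+1.
Proof.
move=> uw Eu Ew h; rewrite -(eq_tor_idl _ _ (add_edge_adj E u w)) -[j.+1]addn1.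
have [h1 h2] := edge_coef u w.
by apply: tor_regular_le h1 h2 _ _ h; [apply: edges_homog|apply: regular_edge].
Qed.

Lemma add_edge_tor_ge E u w i j : u != w -> avoids E u -> avoids E w ->
  T (edges (add_edge E u w)) i j ->
  T (edges E) i j \/ exists i' j', [/\ i = i'.+1, j = j'.+1 & T (edges E) i' j'].
Proof.
move=> uw Eu Ew; rewrite -(eq_tor_idl _ _ (add_edge_adj E u w)).
have [h1 h2] := edge_coef u w.
case/(tor_regular_ge (@edges_homog E) (regular_edge uw Eu Ew) h1 h2); first by left.
by move=> [i' [j' [-> -> h]]]; right; exists i', j'; rewrite addn1.
Qed.

End EdgeIdeals.

(** * Complete graphs *)

Section Complete.
Variables (K : fieldType) (V : finType).
Local Notation n := #|{: V + V}|.
Local Notation S := {mpoly K[n]}.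
Local Notation x := (xvar K).
Local Notation y := (yvar K).
Local Notation edge := (edge_binomial K).
Implicit Types (E H : rel V) (u v w a : V) (W : {set V}) (m : 'X_{1..n}).

Definition complete_on W : rel V := fun u w => [&& u \in W, w \in W & u != w].

Lemma sum_variables (F : 'I_n -> nat) :
  (\sum_k F k = \sum_u F (xidx u) + \sum_u F (yidx u))%N.
Proof.
rewrite (reindex (@enum_rank (V + V)%type)) /=; last exact/onW_bij/enum_rank_bij.
by rewrite big_sumType.
Qed.

(* The parametrization x_u |-> x_u, y_u |-> x_u * t for u in W, where the role
   of the parameter t is played by y_a for some a in W. *)
Definition param_mon W a (k : 'I_n) : 'X_{1..n} :=
  match enum_val k with
  | inr u => if u \in W then (U_(xidx u) + U_(yidx a))%MM else U_(k)%MM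
  | inl _ => U_(k)%MM
  end.

Lemma param_mon_x W a u : param_mon W a (xidx u) = U_(xidx u)%MM.
Proof. by rewrite /param_mon enum_rankK. Qed.

Lemma param_mon_y W a u : param_mon W a (yidx u) =
  if u \in W then (U_(xidx u) + U_(yidx a))%MM else U_(yidx u)%MM.
Proof. by rewrite /param_mon enum_rankK. Qed.

Definition param W a (f : S) : S := f \mPo [tuple 'X_[param_mon W a k] | k < n].

Lemma param0 W a : param W a 0 = 0. Proof. exact: comp_mpoly0. Qed.

Lemma paramD W a f g : param W a (f + g) = param W a f + param W a g.
Proof. exact: comp_mpolyD. Qed.

Lemma paramB W a f g : param W a (f - g) = param W a f - param W a g.
Proof. exact: comp_mpolyB. Qed.

Lemma paramM W a f g : param W a (f * g) = param W a f * param W a g.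
Proof. exact: rmorphM. Qed.

Lemma paramZ W a c f : param W a (c *: f) = c *: param W a f.
Proof. exact: comp_mpolyZ. Qed.

Lemma paramX W a k : param W a 'X_k = 'X_[param_mon W a k].
Proof. by rewrite /param comp_mpolyXU -tnth_nth tnth_mktuple. Qed.

Definition param_exp W a m := (\sum_k param_mon W a k *+ m k)%MM.

Lemma paramXm W a m : param W a 'X_[m] = 'X_[param_exp W a m].
Proof.
rewrite /param comp_mpolyX -mprodXnE; apply: eq_bigr => k _.
by rewrite tnth_mktuple.
Qed.

Lemma param_exp_x W a m u :
  (param_exp W a m (xidx u) = m (xidx u) + (u \in W) * m (yidx u))%N.
Proof.
rewrite /param_exp mnm_sumE; under eq_bigr => k _ do rewrite mulmnE.
rewrite sum_variables; congr (_ + _)%N.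
  rewrite (bigD1 u) //= param_mon_x mnm1E eqxx mul1n big1 ?addn0 // => v vu.
  by rewrite param_mon_x mnm1E eq_xidx (negbTE vu).
rewrite (bigD1 u) //= param_mon_y big1 => [|v vu].
  rewrite addn0; case: ifP => _; rewrite ?mnmDE !mnm1E ?eqxx [yidx _ == _]eq_sym neq_xyidx //.
by rewrite param_mon_y; case: ifP => _; rewrite ?mnmDE !mnm1E ?eq_xidx ?(negbTE vu)
  [yidx _ == _]eq_sym neq_xyidx.
Qed.

Lemma param_exp_y W a m u : a \in W -> u \notin W ->
  param_exp W a m (yidx u) = m (yidx u).
Proof.
move=> aW uW; rewrite /param_exp mnm_sumE; under eq_bigr => k _ do rewrite mulmnE.
rewrite sum_variables big1 ?add0n => [|v _]; last by rewrite param_mon_x mnm1E neq_xyidx.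
rewrite (bigD1 u) //= param_mon_y (negbTE uW) mnm1E eqxx mul1n big1 ?addn0 // => v vu.
rewrite param_mon_y; case: ifP => vW; rewrite ?mnmDE !mnm1E ?neq_xyidx ?eq_yidx ?(negbTE vu) //.
by case: eqP => // au; rewrite -au aW in uW.
Qed.

Lemma param_exp_sum W a m : a \in W ->
  (param_exp W a m (yidx a) = \sum_(u in W) m (yidx u))%N.
Proof.
move=> aW; rewrite /param_exp mnm_sumE; under eq_bigr => k _ do rewrite mulmnE.
rewrite sum_variables big1 ?add0n => [|v _]; last by rewrite param_mon_x mnm1E neq_xyidx.
rewrite [RHS]big_mkcond; apply: eq_bigr => u _; rewrite param_mon_y.
case: ifP => uW; first by rewrite mnmDE !mnm1E neq_xyidx eqxx mul1n.
rewrite mnm1E eq_yidx; case: eqP => // ua; by rewrite ua aW in uW.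
Qed.

(** What equality of the images under [param_exp] amounts to when [a] is in W. *)
Definition same_content W m m' :=
  [/\ forall u, (m (xidx u) + (u \in W) * m (yidx u) = m' (xidx u) + (u \in W) * m' (yidx u))%N,
      forall u, u \notin W -> m (yidx u) = m' (yidx u)
    & (\sum_(u in W) m (yidx u) = \sum_(u in W) m' (yidx u))%N].

Lemma param_exp_content W a m m' : a \in W ->
  param_exp W a m = param_exp W a m' -> same_content W m m'.
Proof.
move=> aW h; split=> [u|u uW|].
- by rewrite -(param_exp_x W a m) h param_exp_x.
- by rewrite -(param_exp_y m aW uW) h param_exp_y.
by rewrite -(param_exp_sum m aW) h param_exp_sum.
Qed.

(** Replacing a factor y_u x_w of a monomial by x_u y_w changes it by an element of the ideal and
    keeps its content. Such exchanges turn m into m'; the total excess of y-exponents of m over m'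
    decreases each time. *)
Lemma same_content_idl W m m' : same_content W m m' ->
  idl (edges (complete_on W)) ('X_[m] - 'X_[m'] : S).
Proof.
have [d] := ubnP (\sum_(u in W) (m (yidx u) - m' (yidx u)))%N.
elim: d m => // d IH m hd [c1 c2 c3].
case: (classic (exists2 u, u \in W & (m' (yidx u) < m (yidx u))%N)) => [[u uW lt]|nu]; last first.
  have le u : u \in W -> (m (yidx u) <= m' (yidx u))%N.
    by move=> uW; rewrite leqNgt; apply/negP => lt; apply: nu; exists u.
  have eqy u : m (yidx u) = m' (yidx u).
    case: (boolP (u \in W)) => [uW|]; last exact: c2.
    move: c3; rewrite (bigD1 u) //= [RHS](bigD1 u) //= => c3.
    have : (\sum_(v in W | v != u) m (yidx v) <= \sum_(v in W | v != u) m' (yidx v))%N.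
      by apply: leq_sum => v /andP[vW _]; apply: le.
    by have := le u uW; lia.
  suff -> : m = m' by rewrite subrr; apply: Idl0.
  apply/mnmP => k; rewrite -(enum_valK k); case: (enum_val k) => u; last exact: eqy.
  by have := c1 u; rewrite eqy => /eqP; rewrite eqn_add2r => /eqP.
have [w wW ltw] : exists2 w, w \in W & (m (yidx w) < m' (yidx w))%N.
  apply: NNPP => nw.
  have le v : v \in W -> (m' (yidx v) <= m (yidx v))%N.
    by move=> vW; rewrite leqNgt; apply/negP => lt'; apply: nw; exists v.
  move: c3; rewrite (bigD1 u) //= [RHS](bigD1 u) //= => c3.
  have : (\sum_(v in W | v != u) m' (yidx v) <= \sum_(v in W | v != u) m (yidx v))%N.
    by apply: leq_sum => v /andP[vW _]; apply: le.
  by move: lt c3; lia.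
have uw : u != w by apply/eqP => uw; move: lt ltw; rewrite uw; lia.
(* x_w divides the monomial because the contents at w agree while the exponent of y_w is smaller in
   m than in m'. *)
have [mu mE] : exists mu, m = (mu + (U_(yidx u) + U_(xidx w)))%MM.
  exists (m - (U_(yidx u) + U_(xidx w)))%MM; rewrite submK //; apply/mnm_lepP => k.
  rewrite mnmDE !mnm1E; case: (eqVneq (yidx u) k) => [<-|_].
    by rewrite neq_xyidx; lia.
  by case: eqP => [<-|//]; have := c1 w; rewrite wW; lia.
pose m2 := (mu + (U_(xidx u) + U_(yidx w)))%MM.
have mx v : m (xidx v) = (mu (xidx v) + (w == v))%N.
  by rewrite mE !mnmDE !mnm1E eq_xidx [yidx _ == _]eq_sym neq_xyidx.
have my v : m (yidx v) = (mu (yidx v) + (u == v))%N.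
  by rewrite mE !mnmDE !mnm1E eq_yidx neq_xyidx addn0.
have m2x v : m2 (xidx v) = (mu (xidx v) + (u == v))%N.
  by rewrite !mnmDE !mnm1E eq_xidx [yidx _ == _]eq_sym neq_xyidx addn0.
have m2y v : m2 (yidx v) = (mu (yidx v) + (w == v))%N.
  by rewrite !mnmDE !mnm1E eq_yidx neq_xyidx.
have notinW t v : t \in W -> v \notin W -> (t == v) = false.
  by move=> tW vW; apply: contraNF vW => /eqP <-.
have sum1W t : t \in W -> (\sum_(v in W) (t == v) = 1)%N.
  move=> tW; rewrite (bigD1 t) //= eqxx big1 // => v /andP[_].
  by rewrite eq_sym => /negbTE->.
have -> : 'X_[m] - 'X_[m'] = ('X_[m] - 'X_[m2]) + ('X_[m2] - 'X_[m']) :> S.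
  by rewrite addrA subrK.
apply: idlAdd; last first.
  apply: IH.
    rewrite -ltnS; apply: leq_trans hd; rewrite ltnS.
    rewrite (bigD1 u) //= [X in (_ < X)%N](bigD1 u) //= -addSn leq_add //.
      by move: lt; rewrite my m2y eqxx [w == u]eq_sym (negbTE uw); lia.
    apply: leq_sum => v /andP[vW vu]; rewrite my m2y [u == v]eq_sym (negbTE vu).
    by case: eqP => // <-; move: ltw; rewrite my (negbTE uw); lia.
  split=> [v|v vW|].
  - rewrite -c1 mx my m2x m2y; case: (boolP (v \in W)) => vW; first lia.
    by rewrite !(notinW _ v) // !mul0n.
  - by rewrite -c2 // my m2y !(notinW _ v).
  rewrite -c3; under eq_bigr => v _ do rewrite m2y.
  by under [RHS]eq_bigr => v _ do rewrite my; rewrite !big_split /= !sum1W.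
have -> : 'X_[m] - 'X_[m2] = - 'X_[mu] * edge u w :> S.
  rewrite mE /m2 !mpolyXD /edge_binomial mulNr -mulrN opprB -mulrBr.
  by rewrite [x w * _]mulrC.
by apply/idlM/idl_gen; exists u, w; rewrite /complete_on uW wW.
Qed.

Lemma param_edges W a f : idl (edges (complete_on W)) f -> param W a f = 0.
Proof.
elim=> [|b g h [u [w [/and3P[uW wW _] ->]]] _ hh]; first exact: param0.
rewrite paramD paramM hh addr0 /edge_binomial paramB !paramM !paramX.
rewrite !param_mon_x !param_mon_y uW wW !mpolyXD.
by rewrite [X in _ - X]mulrCA subrr mulr0.
Qed.

Lemma paramE W a f : param W a f = \sum_(m <- msupp f) f@_m *: 'X_[param_exp W a m].
Proof.
rewrite {1}[f]mpolyE /param linear_sum /=; apply: eq_bigr => m _.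
by rewrite comp_mpolyZ -paramXm.
Qed.

(** The image of each monomial of f must cancel against that of another monomial of f; subtracting a
    multiple of their difference, which is in the ideal, shortens the support. *)
Lemma param_kernel W a f : a \in W -> param W a f = 0 -> idl (edges (complete_on W)) f.
Proof.
move=> aW; have [d] := ubnP (size (msupp f)); elim: d f => // d IH f hd hf.
case: (eqVneq f 0) => [->|f0]; first exact: Idl0.
have [m mf] : exists m, m \in msupp f.
  by case E : (msupp f) => [|m s]; [move: f0; rewrite -msupp_eq0 E|exists m; rewrite inE eqxx].
have [m' [m'f m'm ee]] : exists m', [/\ m' \in msupp f, m' != m
    & param_exp W a m = param_exp W a m'].
  apply: NNPP => nE; move: (mf); rewrite mcoeff_msupp => /eqP; apply.
  have := congr1 (mcoeff (param_exp W a m)) hf; rewrite paramE mcoeff0 => <-.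
  rewrite raddf_sum /= (bigD1_seq m) ?msupp_uniq //= mcoeffZ mcoeffX eqxx mulr1.
  rewrite big_seq_cond big1 ?addr0 // => k /andP[kf km].
  rewrite mcoeffZ mcoeffX; case: eqP => [ee|]; last by rewrite mulr0.
  by case: nE; exists k.
pose f' := f - f@_m *: ('X_[m] - 'X_[m']).
have -> : f = f' + (f@_m)%:MP * ('X_[m] - 'X_[m']) by rewrite mul_mpolyC subrK.
apply: idlAdd; last by apply/idlM/same_content_idl/(param_exp_content aW).
apply: IH; last first.
  by rewrite paramB paramZ paramB hf !paramXm ee subrr scaler0 subr0.
rewrite -ltnS; apply: leq_trans hd; rewrite ltnS.
have : (size (msupp f') <= size (rem m (msupp f)))%N.
  apply: uniq_leq_size (msupp_uniq _) _ => k; rewrite mem_rem_uniq ?msupp_uniq //.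
  rewrite !inE !mcoeff_msupp /f' mcoeffB mcoeffZ mcoeffB !mcoeffX.
  case: (eqVneq m k) => [<-|mk].
    by rewrite (negbTE m'm) /= subr0 mulr1 subrr eqxx.
  case: (eqVneq m' k) => [<-|m'k] /=; last by rewrite subrr mulr0 subr0.
  by move=> _; rewrite -mcoeff_msupp.
by rewrite size_rem //; case: (msupp f) mf.
Qed.

(** The ideal is the kernel of a map to a domain that does not kill x_a. *)
Lemma regular_complete W a : a \in W -> regular_mod (idl (edges (complete_on W))) (x a).
Proof.
move=> aW f /param_edges-/(_ a)/eqP; rewrite paramM paramX mulf_eq0 => /orP[/eqP/(congr1 (mcoeff (param_mon W a (xidx a))))/eqP|/eqP].
  by rewrite mcoeffX eqxx mcoeff0 oner_eq0.
exact: param_kernel.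
Qed.

End Complete.

(** * Tor of complete graphs, by induction on the number of vertices *)

Section CompleteTor.
Variables (K : fieldType) (V : finType).
Local Notation n := #|{: V + V}|.
Local Notation S := {mpoly K[n]}.
Local Notation x := (xvar K).
Local Notation y := (yvar K).
Local Notation edge := (edge_binomial K).
Local Notation T P := (tor_nz (poly_grading K n) (fun=> True) (idl P)).
Implicit Types (u v w a : V) (W : {set V}) (f : S).

Lemma avoids_complete W a : a \notin W -> avoids (complete_on W) a.
Proof.
move=> aW u w /and3P[uW wW _].
by split; apply: contraNneq aW => <-.
Qed.

Section Step.
Variables (W : {set V}) (a : V).
Hypothesis aW : a \notin W.
Local Notation W' := (a |: W).
Local Notation P1 := (edges_vars (K := K) (complete_on W') [set xidx a]).

Let xs : {set 'I_n} := [set xidx u | u in W'].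

Let mem_xs u : (xidx u \in xs) = (u \in W').
Proof. by rewrite mem_imset // => v w /eqP; rewrite eq_xidx => /eqP. Qed.

Lemma card_xs : #|xs| = #|W|.+1.
Proof. by rewrite card_imset ?cardsU1 ?aW // => u w /eqP; rewrite eq_xidx => /eqP. Qed.

Lemma complete_quotient f :
  idl (adj P1 (y a)) f <-> idl (edges_vars (complete_on W) (vidx a)) f.
Proof.
split; apply: idl_sub => g; last first.
  case=> [[u [w [/and3P[uW wW uw] ->]]]|[k]].
    apply: idl_gen; left; left; exists u, w.
    by rewrite /complete_on !inE uW wW uw !orbT.
  rewrite !inE => /orP[/eqP-> ->|/eqP-> ->]; apply: idl_gen; last by right.
  by left; right; exists (xidx a); rewrite ?inE.
case=> [[[u [w [/and3P[uW wW uw] ->]]]|[k /set1P -> ->]]|->].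
- move: uW wW; rewrite !inE; case: (eqVneq u a) => [->|_] /=.
    by move=> _ _; apply: idl_edges_vidx.
  case: (eqVneq w a) => [->|_] /=.
    by move=> _ _; apply: idl_edges_vidxC.
  by move=> uW wW; apply: idl_gen; left; exists u, w; rewrite /complete_on uW wW.
- by rewrite -[X in idl _ X]mulr1; apply: idl_edges_var; rewrite !inE eqxx.
by rewrite -[X in idl _ X]mulr1; apply: idl_edges_var; rewrite !inE eqxx orbT.
Qed.

(** Modulo P1, y_a x_u equals x_a y_u, hence 0, for every u in W'. Conversely P1 is contained in the
    ideal of these x_u, which is prime and does not contain y_a. *)
Lemma complete_colon f : idl P1 (y a * f) <-> idl (vars xs) f.
Proof.
split=> [h|].
  have hk g : idl P1 g -> kill xs g = 0.
    elim=> [|b p q [[u [w [/and3P[uW wW _] ->]]]|[k /set1P -> ->]] _ hq]; first exact: kill0.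
      rewrite killD hq killM /edge_binomial killB !killM !killX !mem_xs uW wW.
      by rewrite !mul0r subrr mulr0 addr0.
    by rewrite killD hq killM killX mem_xs setU11 mulr0 addr0.
  have := hk _ h; rewrite killM killX.
  have -> : (yidx a \in xs) = false.
    by apply/imsetP => -[u _ /eqP]; rewrite eq_sym neq_xyidx.
  move/eqP; rewrite mulf_eq0 => /orP[/eqP/(congr1 (mcoeff U_(yidx a)%MM))/eqP|/eqP k0].
    by rewrite mcoeffX eqxx mcoeff0 oner_eq0.
  by have := kill_decomp xs f; rewrite k0 subr0.
elim=> [|b p q [k /imsetP[u uW ->] ->] _ hq]; first by rewrite mulr0; apply: Idl0.
rewrite mulrDr; apply: idlAdd => //; rewrite mulrCA; apply: idlM.
case: (eqVneq u a) => [->|ua].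
  by apply/idlM/idl_gen; right; exists (xidx a); rewrite ?inE.
have -> : y a * 'X_(xidx u) = x a * y u - edge a u.
  by rewrite /edge_binomial opprB addrC subrK mulrC.
apply: idlB; first by apply/idlMr/idl_gen; right; exists (xidx a); rewrite ?inE.
by apply: idl_gen; left; exists a, u; rewrite /complete_on setU11 uW eq_sym ua.
Qed.

Lemma edges_var_adj E k f :
  idl (adj (edges E) 'X_k) f <-> idl (edges_vars (K := K) E [set k]) f.
Proof.
split; apply: idlW => g.
  by case=> [h|->]; [left|right; exists k; rewrite ?inE].
by case=> [h|[l /set1P -> ->]]; [left|right].
Qed.

Variable s : nat.
Hypothesis cardW : #|W| = s.+1.
Hypothesis IH : forall i j, T (edges (complete_on W)) i j -> (i <= s)%N /\ (j <= 1)%N.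

Let y_homog : y a \is 1.-homog. Proof. exact: homog_X. Qed.

Let tor_A i j : T (adj P1 (y a)) i j -> (i <= s.+2)%N /\ (j <= 1)%N.
Proof.
rewrite (eq_tor_idl _ _ complete_quotient) => /(vidx_tor_ge (avoids_complete aW)).
by move=> [i' [/IH[h1 h2] h3]]; split=> //; lia.
Qed.

Let tor_AB i j : tor_nz (poly_grading K n) (idl (adj P1 (y a))) (idl P1) i j ->
  (i <= s.+2)%N /\ j = 1%N.
Proof.
case/(tor_colon_ge (@edges_vars_homog _ _ _ _) y_homog complete_colon) => j' ->.
by move=> /tor_vars[]; rewrite card_xs cardW => h ->.
Qed.

Let BA f : idl P1 f -> idl (adj P1 (y a)) f.
Proof. by apply: idlW => g; left. Qed.

Let sT : @is_submod _ S^o (fun=> True). Proof. by []. Qed.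

Let sub_tor := @tor_nz_sub K n S^o (poly_grading K n) (idl (adj P1 (y a))) (idl P1) (fun=> True).
Let mid_tor := @tor_nz_mid K n S^o (poly_grading K n) (idl (adj P1 (y a))) (idl P1) (fun=> True).

Let tor_B i j : T P1 i j -> (i <= s.+2)%N /\ (j <= 1)%N.
Proof.
case/(mid_tor sT BA (fun _ _ => I)) => [/tor_AB[-> ->]//|]; exact: tor_A.
Qed.

(** The s + 2 variables of the colon ideal give a class at (s + 2, 0), moved to row 1 by the degree
    of y_a. It could only be lost to position (s + 3, 0) of the quotient by (P1, y_a), which is out
    of range. *)
Let tor_B_max : T P1 s.+2 1.
Proof.
have : tor_nz (poly_grading K n) (idl (adj P1 (y a))) (idl P1) s.+2 1.
  apply: (proj1 (tor_colon (@edges_vars_homog _ _ _ _) y_homog complete_colon s.+2 0)).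
  by have := tor_vars_max K xs; rewrite card_xs cardW.
case/(sub_tor (idl_submod _) sT BA (fun _ _ => I)) => // -[j' [_ /tor_A[]]].
by rewrite ltnn.
Qed.

Lemma complete_step_bound i j : T (edges (complete_on W')) i j -> (i <= s.+1)%N /\ (j <= 1)%N.
Proof.
move=> h; have := tor_X_le (@edges_homog _ _ _) (@regular_complete K _ _ _ (setU11 a W)) h.
by rewrite (eq_tor_idl _ _ (edges_var_adj _ _)) => /tor_B.
Qed.

Lemma complete_step_max : T (edges (complete_on W')) s.+1 1.
Proof.
have := tor_B_max; rewrite -(eq_tor_idl _ _ (edges_var_adj _ _)).
case/(tor_X_ge (@edges_homog _ _ _) (@regular_complete K _ _ _ (setU11 a W))).
  by move=> /complete_step_bound[]; rewrite ltnn.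
by case=> i' [<-].
Qed.

End Step.

(** This is the shape of the Eagon-Northcott resolution: rows 0 and 1 and length s. With a single
    vertex the ideal is zero, hence the proviso on s. *)
Lemma complete_tor W s : #|W| = s.+1 ->
  (forall i j, T (edges (complete_on W)) i j -> (i <= s)%N /\ (j <= 1)%N) /\
  ((0 < s)%N -> T (edges (complete_on W)) s 1).
Proof.
elim: s W => [|s IH] W cW.
  split=> // i j h; have /tor_free[-> ->] // : T (@no_gen K n) i j.
  move: h; apply: (proj1 (eq_tor_idl _ _ _)) => f.
  split; last by move=> h; apply: idlW h.
  apply: idl_sub => g [u [w [/and3P[uW wW uw] _]]].
  have /cards1P[a aE] : #|W| == 1%N by rewrite cW.
  by move: uW wW uw; rewrite aE !inE => /eqP-> /eqP->; rewrite eqxx.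
have [a aW] : exists a, a \in W by apply/set0Pn; rewrite -cards_eq0 cW.
have aW1 : a \notin W :\ a by rewrite !inE eqxx.
have cW1 : #|W :\ a| = s.+1 by move: cW; rewrite (cardsD1 a) aW => -[].
have [IH1 _] := IH _ cW1; rewrite -(setD1K aW); split.
  exact: (complete_step_bound aW1 cW1 IH1).
by move=> _; apply: (complete_step_max aW1 cW1 IH1).
Qed.

End CompleteTor.

(** * Cones *)

Section Cone.
Variables (K : fieldType) (V : finType) (H : rel V) (W : {set V}) (v : V) (s : nat).
Local Notation n := #|{: V + V}|.
Local Notation S := {mpoly K[n]}.
Local Notation x := (xvar K).
Local Notation y := (yvar K).
Local Notation edge := (edge_binomial K).
Local Notation Tor A B := (tor_nz (poly_grading K n) A B).
Local Notation T P := (tor_nz (poly_grading K n) (fun=> True) (idl P)).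
Implicit Types (f : S).

Definition cone : rel V := fun a b => [|| H a b, (a == v) && (b \in W) | (b == v) && (a \in W)].

Hypotheses (HW : forall a b, H a b -> [&& a \in W, b \in W & a != b]) (vW : v \notin W).
Hypothesis cardW : #|W| = s.+2.

Local Notation J := (edges (K := K) cone).
Local Notation Q := (edges (K := K) (complete_on (v |: W))).
Local Notation Y := (edges_vars (K := K) H (vidx v)).
Local Notation QY := (edges_vars (K := K) (complete_on W) (vidx v)).

Lemma avoids_cone_base : avoids H v.
Proof. by move=> a b /HW/and3P[aW bW _]; split; apply: contraNneq vW => <-. Qed.

Let edge_cone w : w \in W -> idl J (edge v w).
Proof. by move=> wW; apply: idl_gen; exists v, w; rewrite /cone eqxx wW orbT. Qed.

Lemma cone_sub_complete f : idl J f -> idl Q f.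
Proof.
apply: idl_sub => g [a [b [/or3P[/HW/and3P[aW bW ab]|/andP[/eqP -> bW]|/andP[/eqP -> aW]] ->]]].
- by apply: idl_gen; exists a, b; rewrite /complete_on !inE aW bW ab !orbT.
- apply: idl_gen; exists v, b; rewrite /complete_on !inE bW eqxx orbT /=.
  by split=> //; apply: contraNneq vW => ->.
apply: idl_gen; exists a, v; rewrite /complete_on !inE aW eqxx orbT /=.
by split=> //; apply: contraNneq vW => <-.
Qed.

Lemma cone_sub_vertex f : idl J f -> idl Y f.
Proof.
apply: idl_sub => g [a [b [/or3P[ab|/andP[/eqP -> bW]|/andP[/eqP -> aW]] ->]]].
- by apply: idl_gen; left; exists a, b.
- exact: idl_edges_vidx.
exact: idl_edges_vidxC.
Qed.

Let kill_W a b : a \in W -> b \in W -> kill (vidx v) (edge a b) = edge a b.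
Proof.
move=> aW bW; have ne c : c \in W -> c != v by move=> cW; apply: contraNneq vW => <-.
apply: kill_edge; rewrite !inE ?eq_xidx ?eq_yidx ?neq_xyidx ?[yidx _ == xidx _]eq_sym
  ?neq_xyidx ?orbF ?ne //.
Qed.

(* x_v (x_a y_b - x_b y_a) and y_v (x_a y_b - x_b y_a) are combinations of the
   binomials of the edges from v to a and b. *)
Let cone_triangle a b : a \in W -> b \in W ->
  forall f, idl (vars (vidx v)) f -> idl J (f * edge a b).
Proof.
move=> aW bW f; elim=> [|c g h [k kv ->] _ IH]; first by rewrite mul0r; apply: Idl0.
rewrite mulrDl -mulrA; apply: idlAdd => //; apply: idlM.
move: kv; rewrite !inE => /orP[]/eqP->.
  have -> : 'X_(xidx v) * edge a b = x a * edge v b - x b * edge v a.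
    rewrite /edge_binomial -/(x v); ring.
  by apply: idlB; apply/idlM/edge_cone.
have -> : 'X_(yidx v) * edge a b = y a * edge v b - y b * edge v a.
  rewrite /edge_binomial -/(y v); ring.
by apply: idlB; apply/idlM/edge_cone.
Qed.

Let complete_kill f : idl Q f -> idl J (f - kill (vidx v) f).
Proof.
elim=> [|c g h [a [b [/and3P[aW bW ab] ->]]] _ IH]; first by rewrite kill0 subrr; apply: Idl0.
rewrite killD killM opprD addrACA; apply: idlAdd => //.
move: aW bW; rewrite !inE; case: (eqVneq a v) => [av|av] /=.
  case: (eqVneq b v) => [bv|bv] /= _ => [|bW]; first by rewrite av bv eqxx in ab.
  rewrite av; have -> : kill (vidx v) (edge v b) = 0.
    by rewrite /edge_binomial killB !killM !killX !inE !eqxx /= ?orbT !mul0r mulr0 subr0.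
  by rewrite mulr0 subr0; apply/idlM/edge_cone.
case: (eqVneq b v) => [bv|bv] /= aW => [_|bW].
  rewrite bv edgeC; have -> : kill (vidx v) (- edge v a) = 0.
    rewrite -[- _]sub0r killB kill0 /edge_binomial killB !killM !killX !inE !eqxx /= ?orbT.
    by rewrite !mul0r mulr0 !subr0.
  by rewrite mulr0 subr0 mulrN -mulNr; apply/idlM/edge_cone.
by rewrite kill_W // -mulrBl; apply: cone_triangle => //; apply: kill_decomp.
Qed.

Let vertex_kill f : idl Y f -> idl J (kill (vidx v) f).
Proof.
elim=> [|c g h hg _ IH]; first by rewrite kill0; apply: Idl0.
rewrite killD killM; apply: idlAdd => //; apply: idlM.
case: hg => [[a [b [ab ->]]]|[k kv ->]]; last by rewrite killX kv; apply: Idl0.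
have /and3P[aW bW _] := HW ab.
by rewrite kill_W //; apply: idl_gen; exists a, b; rewrite /cone ab.
Qed.

(** This is J = Q /\ Y. Write f as its value at x_v = y_v = 0 plus the rest: for f in Q the rest is
    in J by [cone_triangle], and for f in Y that value is in J because edges of H are edges of the
    cone. *)
Lemma cone_inter f : idl Q f -> (idl J f <-> idl Y f).
Proof.
move=> Qf; split; first exact: cone_sub_vertex.
move=> Yf; rewrite -[f](subrK (kill (vidx v) f)).
by apply: idlAdd; [apply: complete_kill|apply: vertex_kill].
Qed.

Lemma complete_sum f : idl QY f -> exists2 q, idl Q q & idl Y (f - q).
Proof.
elim=> [|c g h hg _ [q Qq Yq]]; first by exists 0; [apply: Idl0|rewrite subrr; apply: Idl0].
case: hg => [[a [b [/and3P[aW bW ab] ->]]]|hg].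
  exists (c * edge a b + q).
    by apply: IdlD => //; exists a, b; rewrite /complete_on !inE aW bW ab !orbT.
  by rewrite opprD addrACA subrr add0r.
exists q => //; rewrite -addrA; apply: idlAdd => //.
by apply/idlM/idl_gen; right.
Qed.

Lemma complete_sub_sum f : idl Q f -> idl QY f.
Proof.
apply: idl_sub => g [a [b [/and3P[aW bW ab] ->]]].
move: aW bW; rewrite !inE; case: (eqVneq a v) => [-> _ _|av] /=; first exact: idl_edges_vidx.
case: (eqVneq b v) => [->|bv] /= aW bW; first exact: idl_edges_vidxC.
by apply: idl_gen; left; exists a, b; rewrite /complete_on aW bW.
Qed.

Lemma vertex_sub_sum f : idl Y f -> idl QY f.
Proof.
apply: idlW => g [[a [b [ab ->]]]|h]; [left|by right].
by exists a, b; split=> //; apply: HW.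
Qed.

(** Noether's isomorphism Q/(Q /\ Y) = (Q + Y)/Y. It splices the sequences of J in Q and of Y in Q +
    Y, which does the work of Mayer-Vietoris. *)
Lemma tor_cone_iso i j : Tor (idl Q) (idl J) i j <-> Tor (idl QY) (idl Y) i j.
Proof.
rewrite -[X in _ <-> tor_nz _ _ _ _ X]addn0.
apply: (@tor_nz_transfer K n S^o S^o (poly_grading K n) (poly_grading K n) (fun f => f) 0
  (idl Q) (idl J) (idl QY) (idl Y)) => //.
- exact: idl_submod.
- exact: idl_submod.
- by move=> d u hu; rewrite addn0.
- exact: complete_sub_sum.
- exact: cone_inter.
move=> d f /complete_sum[q Qq Yq]; rewrite addn0 => hf.
exists (pproj d q); split; last 1 first.
- rewrite -{1}(pproj_id hf) -pprojB; apply: idl_graded Yq.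
  exact: edges_vars_homog.
- by apply: idl_graded Qq; apply: edges_homog.
exact: phom_pproj.
Qed.

Let sT : @is_submod _ S^o (fun=> True). Proof. by []. Qed.

Let tor_Q i j : T Q i j -> (i <= s.+2)%N /\ (j <= 1)%N.
Proof.
have c : #|v |: W| = s.+3 by rewrite cardsU1 vW cardW.
by apply: (proj1 (complete_tor K c)).
Qed.

Let tor_QY i j : T QY i j -> (i <= s.+3)%N /\ (j <= 1)%N.
Proof.
case/(vidx_tor_ge (avoids_complete vW)) => i' [h hi].
by have [h1 h2] := proj1 (complete_tor K cardW) _ _ h; split=> //; lia.
Qed.

Let tor_QY_max : T QY s.+3 1.
Proof.
apply: vidx_tor_le; first exact: avoids_complete.
exact: (proj2 (complete_tor K cardW)).
Qed.

Let mid A B := @tor_nz_mid K n S^o (poly_grading K n) A B (fun=> True).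
Let conn A B := @tor_nz_conn K n S^o (poly_grading K n) A B (fun=> True).
Let sub A B := @tor_nz_sub K n S^o (poly_grading K n) A B (fun=> True).

Lemma cone_tor_ge i j : T J i j -> ((i <= s.+2)%N /\ (j <= 2)%N) \/ T Y i j.
Proof.
case/(mid sT cone_sub_complete (fun _ _ => I)) => [|/tor_Q[h1 h2]]; last first.
  by left; split=> //; apply: leq_trans h2 _.
rewrite tor_cone_iso.
case/(sub (idl_submod _) sT vertex_sub_sum (fun _ _ => I)) => [|[j' [-> /tor_QY[h1 h2]]]].
  by right.
by left.
Qed.

(** The last Tor class of S/(Q + Y) does not come from S/Y, so the connecting map sends it to (s +
    2, 2); there it survives in S/J, since S/Q has nothing at s + 3. *)
Lemma cone_tor_top : ~ T Y s.+3 1 -> T J s.+2 2.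
Proof.
move=> nY; case/(conn (idl_submod _) (idl_submod _) sT vertex_sub_sum (fun _ _ => I)): tor_QY_max => // -[_ [[<-]]].
rewrite -tor_cone_iso.
case/(sub (idl_submod _) sT cone_sub_complete (fun _ _ => I)) => // -[j' [_ /tor_Q[]]].
by rewrite ltnn.
Qed.

(** S/(Q + Y) has nothing in row j and S/Q nothing in row j - 1, as both stop at row 1. *)
Lemma cone_tor_le i j : T Y i j -> (2 < j)%N -> T J i j.
Proof.
move=> h hj; case/(mid sT vertex_sub_sum (fun _ _ => I)): h => [|/tor_QY[_]]; last by lia.
rewrite -tor_cone_iso.
case/(sub (idl_submod _) sT cone_sub_complete (fun _ _ => I)) => // -[j' [jE /tor_Q[_]]].
by lia.
Qed.

End Cone.

(** * Profiles *)

Local Notation T K E :=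
  (tor_nz (poly_grading K _) (fun=> True) (idl (edges (K := K) E))).

(** The maximum with [lo] bounds the rows below [lo] by the corner of row [lo], so they contain no
    extremal position. *)
Definition has_profile (K : fieldType) (V : finType) (E : rel V) r lo (p : nat -> nat) :=
  (forall i j, T K E i j -> (j <= r)%N /\ (i <= p (maxn j lo))%N) /\
  (forall j, (lo <= j)%N -> (j <= r)%N -> T K E (p j) j).

Lemma eq_profile (K : fieldType) (V : finType) (E E' : rel V) r lo p :
  E =2 E' -> has_profile K E r lo p -> has_profile K E' r lo p.
Proof.
move=> EE.
have sub (E1 E2 : rel V) f : E1 =2 E2 -> idl (edges (K := K) E1) f -> idl (edges E2) f.
  by move=> e12; apply: idlW => g [a [b [ab ->]]]; exists a, b; rewrite -e12.
have TE i j : T K E i j <-> T K E' i j.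
  by apply: eq_tor_idl => f; split; apply: sub => // a b; rewrite EE.
by case=> h1 h2; split=> [i j /TE/h1 //|j j1 j2]; apply/TE/h2.
Qed.

(** Besides the shifted classes, unshifted ones may persist; they stay within the new bound because
    p j < p j.-1 + 1 on the decreasing range. *)
Lemma profile_add_edge (K : fieldType) (V : finType) (E : rel V) u w r lo p :
  u != w -> avoids E u -> avoids E w -> (lo <= r)%N ->
  (forall j, (lo <= j)%N -> (j < r)%N -> (p j.+1 < p j)%N) ->
  has_profile K E r lo p ->
  has_profile K (add_edge E u w) r.+1 lo.+1 (fun j => (p j.-1).+1).
Proof.
move=> uw Eu Ew lr decr [h1 h2]; split=> [i j|[//|j] j1 j2]; last first.
  by apply: add_edge_tor_le => //; apply: h2.
case/(add_edge_tor_ge uw Eu Ew) => [/h1[jr ip]|[i' [j' [-> -> /h1[jr ip]]]]]; last first.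
  by rewrite !ltnS maxnSS.
split; first exact: leqW.
case: (leqP j lo) => jlo.
  by move: ip; rewrite (maxn_idPr jlo) (maxn_idPr (leqW jlo)) /= => ip; apply: leqW.
move: ip; rewrite (maxn_idPl (ltnW jlo)) (maxn_idPl jlo) => ip.
by case: j jr jlo ip => // j jr jlo ip; have := decr j jlo jr; rewrite /=; lia.
Qed.

(** The condition p 3 < s has two uses: it keeps Tor of S/Y, where i is at most p 3 + 2 up to row 3,
    inside the bound s + 2, and it makes S/Y vanish at (s + 3, 1), as [cone_tor_top] requires. *)
Lemma profile_cone (K : fieldType) (V : finType) (H : rel V) (W : {set V}) v s r p :
  (forall a b, H a b -> [&& a \in W, b \in W & a != b]) -> v \notin W ->
  #|W| = s.+2 -> (2 < r)%N -> (p 3 < s)%N ->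
  has_profile K H r 3 p ->
  has_profile K (cone H W v) r 2 (fun j => if (j <= 2)%N then s.+2 else (p j).+2).
Proof.
move=> HW vW cW r3 ps [h1 h2].
have Hv := avoids_cone_base HW vW.
have Ybound i j : tor_nz (poly_grading K _) (fun=> True) (idl (edges_vars H (vidx v))) i j ->
    (j <= r)%N /\ (i <= (p (maxn j 3)).+2)%N.
  by case/(vidx_tor_ge Hv) => i' [/h1[jr ip] hi]; split=> //; lia.
split=> [i j /(cone_tor_ge HW vW cW)[[h3 h4]|/Ybound[jr ip]]|j j1 j2].
- by rewrite (maxn_idPr h4) leqnn; split=> //; lia.
- split=> //; case: (leqP j 2) => j2.
    by rewrite /=; move: ip; rewrite (maxn_idPr (leqW j2)); lia.
  by move: ip; rewrite (maxn_idPl j2) [(j <= 2)%N]leqNgt j2.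
case: (leqP j 2) => j3.
  have -> : j = 2%N by lia.
  by apply: (cone_tor_top HW vW cW) => /Ybound[_]; rewrite -[maxn 1 3]/3%N; lia.
by apply: (cone_tor_le HW vW cW) => //; apply: vidx_tor_le => //; apply: h2.
Qed.

Definition restrict N (E : rel nat) : rel 'I_N := fun a b => E a b.

(* Graphs live on initial segments of nat, and isolated vertices may be added
   at will, as they do not change the profile. The function p does not depend
   on the field. *)
Definition realizable r lo := exists m (E : rel nat) (p : nat -> nat),
  [/\ ssrbool.symmetric E, irreflexive E,
      forall a b, E a b -> (a < m)%N,
      forall j, (lo <= j)%N -> (j < r)%N -> (p j.+1 < p j)%N
    & forall K N, (m <= N)%N -> has_profile K (@restrict N E) r lo p].

Lemma realizable0 : realizable 0 0.
Proof.
exists 0%N, (fun _ _ => false), (fun=> 0%N); split=> // K N _.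
have TE i j : T K (@restrict N (fun _ _ => false)) i j <-> 
    tor_nz (poly_grading K #|{: 'I_N + 'I_N}|) (fun=> True) (idl (@no_gen K _)) i j.
  apply: (@eq_tor_idl K _ (edges (@restrict N (fun _ _ => false))) (@no_gen K _)) => f.
  split; last by apply: idlW.
  by apply: idlW => g [a [b [//]]].
split=> [i j /TE/tor_free[-> ->] //|j _].
by rewrite leqn0 => /eqP->; apply/TE/tor_free00.
Qed.

Lemma realizable_edge r lo : (lo <= r)%N -> realizable r lo -> realizable r.+1 lo.+1.
Proof.
move=> lr [m [E [p [Esym Eirr Em decr hE]]]].
have Em' a b : E a b -> (b < m)%N by rewrite Esym; apply: Em.
pose E' a b := [|| E a b, (a == m) && (b == m.+1) | (a == m.+1) && (b == m)].
exists m.+2, E', (fun j => (p j.-1).+1); split.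
- by move=> a b; rewrite /E' Esym; congr orb; rewrite orbC andbC [X in _ || X = _]andbC.
- by move=> a; rewrite /E' Eirr /=; lia.
- by move=> a b /or3P[/Em|/andP[/eqP-> _]|/andP[/eqP-> _]]; lia.
- by move=> [//|j] j1 j2; rewrite ltnS; apply: decr.
move=> K N mN; have mN' : (m < N)%N by lia.
pose u := Ordinal mN'; pose w := Ordinal mN.
apply: (@eq_profile _ _ (add_edge (@restrict N E) u w)); first by [].
apply: profile_add_edge => //.
- by rewrite -val_eqE /=; lia.
- by move=> a b ab; rewrite -!val_eqE /=; have := Em _ _ ab; have := Em' _ _ ab; lia.
- by move=> a b ab; rewrite -!val_eqE /=; have := Em _ _ ab; have := Em' _ _ ab; lia.
by apply: hE; lia.
Qed.

Lemma realizable_cone r : (2 < r)%N -> realizable r 3 -> realizable r 2.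
Proof.
move=> r3 [m [E [p [Esym Eirr Em decr hE]]]].
have Em' a b : E a b -> (b < m)%N by rewrite Esym; apply: Em.
(* W consists of the vertices below k = s + 2. Taking s >= m puts all edges of the old graph inside
   W, and s > p 3 places the new corner beyond the old ones. *)
pose s := (maxn m (p 3).+1)%N; pose k := s.+2.
have mk : (m <= k)%N by rewrite /k /s; lia.
pose E' a b := [|| E a b, (a == k) && (b < k)%N | (b == k) && (a < k)%N].
exists k.+1, E', (fun j => if (j <= 2)%N then s.+2 else (p j).+2); split.
- by move=> a b; rewrite /E' Esym; congr (_ || _); rewrite orbC.
- by move=> a; rewrite /E' Eirr /=; lia.
- by move=> a b /or3P[/Em|/andP[/eqP-> _]|/andP[_]]; lia.
- move=> j j1 j2; case: (leqP j.+1 2) => j3; first lia.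
  case: (leqP j 2) => j4; last by rewrite !ltnS; apply: decr.
  have -> : j = 2%N by lia.
  by rewrite !ltnS /s; lia.
move=> K N kN; pose v := Ordinal kN; pose W := [set a : 'I_N | (a < k)%N].
apply: (@eq_profile _ _ (cone (@restrict N E) W v)).
  by move=> a b; rewrite /cone !inE -!val_eqE.
apply: profile_cone => //.
- move=> a b ab; rewrite !inE; have := Em _ _ ab; have := Em' _ _ ab.
  have : a != b by apply: contraTneq ab => ->; rewrite /restrict Eirr.
  by move=> ->; lia.
- by rewrite inE /= ltnn.
- by rewrite cardsE -sum1_card -(big_ord_widen N (fun=> 1%N) (ltnW kN)) sum1_card card_ord.
- by rewrite /s; lia.
by apply: hE; lia.
Qed.

(** Here [b] counts the cones, so the profile has [b.+1] corners, and [k] counts the edges added at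
    the end. *)
Lemma realizable_corners b k : realizable (b.+2 + k) (2 + k).
Proof.
elim: k => [|k IH]; last by rewrite !addnS; apply: realizable_edge => //; lia.
rewrite !addn0; elim: b => [|b IH].
  by do 2 apply: realizable_edge => //; apply: realizable0.
by apply: realizable_cone => //; apply: realizable_edge.
Qed.

(** * From a profile to regularity and extremal positions *)

Section Extremal.
Variables (beta : nat -> nat -> nat) (r lo : nat) (p : nat -> nat).
Hypothesis lr : (lo <= r)%N.
Hypothesis decr : forall j, (lo <= j)%N -> (j < r)%N -> (p j.+1 < p j)%N.
Hypothesis beta_le : forall i j, beta i (i + j)%N <> 0%N ->
  (j <= r)%N /\ (i <= p (maxn j lo))%N.
Hypothesis beta_corner : forall j, (lo <= j)%N -> (j <= r)%N -> beta (p j) (p j + j)%N <> 0%N.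

Lemma profile_regularity : has_regularity beta r.
Proof.
split; first by exists (p r); apply: beta_corner.
by move=> i j /beta_le[].
Qed.

Lemma profile_decr i j : (lo <= i)%N -> (i < j)%N -> (j <= r)%N -> (p j < p i)%N.
Proof.
move=> li; elim: j => // j IH; rewrite ltnS leq_eqVlt => /orP[/eqP <-|ij] jr.
  exact: decr.
by apply: ltn_trans (IH ij (ltnW jr)); apply: decr => //; lia.
Qed.

(** Every nonzero position (i, j) is dominated by the corner of row max j lo, so an extremal one is
    a corner. Corners do not dominate each other because p strictly decreases. *)
Lemma profile_extremal i j :
  extremal beta (i, j) <-> [/\ (lo <= j)%N, (j <= r)%N & i = p j].
Proof.
split=> [[/beta_le[jr ip] h]|[lj jr ->]].
  have [m1 m2] : (j <= maxn j lo)%N /\ (lo <= maxn j lo)%N by lia.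
  have mr : (maxn j lo <= r)%N by lia.
  case: (eqVneq (p (maxn j lo), maxn j lo) (i, j)) => [[pi mj]|ne].
    by move: m2 mr; rewrite -pi mj => ? ?; split.
  by case: (beta_corner m2 mr); apply: h => //; apply/eqP.
split; first exact: beta_corner.
move=> a c ne pa jc; apply/eqP; case: eqP => // /beta_le[cr].
rewrite (maxn_idPl (leq_trans lj jc)) => ap; case: ne.
move: jc; rewrite leq_eqVlt => /orP[/eqP jE|jc].
  by subst c; congr (_, _); lia.
by have := profile_decr lj jc cr; lia.
Qed.

Lemma profile_extremal_number : extremal_number beta (r - lo).+1.
Proof.
exists [seq (p j, j) | j <- iota lo (r - lo).+1]; split.
- by rewrite map_inj_uniq ?iota_uniq // => j j' [].
- by rewrite size_map size_iota.
move=> [i j]; rewrite profile_extremal; split=> [/mapP[k]|[h1 h2 ->]].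
  by rewrite mem_iota => hk [-> ->]; split=> //; lia.
by apply: map_f; rewrite mem_iota; lia.
Qed.

End Extremal.

Lemma betti_edges (K : fieldType) (V : finType) (E : rel V) r :
  (forall i j, T K E i j -> (j <= r)%N) ->
  forall i j, betti (@binomial_edge_ideal K V E) i (i + j) <> 0%N <-> T K E i j.
Proof.
move=> hr i j.
have TE i' j' : tor_nz (poly_grading K _) (fun=> True) (@binomial_edge_ideal K V E) i' j' <->
    T K E i' j'.
  by split; apply: eq_tor_nz => // f; rewrite binomial_edge_idealE.
rewrite -TE; apply: betti_tor.
- split; first by apply/binomial_edge_idealE; apply: Idl0.
  move=> a f g /binomial_edge_idealE hf /binomial_edge_idealE hg.
  by apply/binomial_edge_idealE/idlAdd => //; apply: idlM.
- move=> d f /binomial_edge_idealE hf; apply/binomial_edge_idealE.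
  by apply: idl_graded hf; apply: edges_homog.
by exists r => i' j' /TE/hr.
Qed.
Local Close Scope ring_scope.

Theorem theorem5p4 (r b : nat) (hr : 0 < r) (hb : 0 < b)
    (hbr : 1 <= b <= r - 1) :
  exists (V : finType) (E : rel V),
    simple_graph E /\
    forall K : fieldType,
      let beta := betti (@binomial_edge_ideal K V E) in
      has_regularity beta r /\ extremal_number beta b.
Proof.
have [m [E [p [Esym Eirr _ decr hE]]]] : realizable r (r - b).+1.
  (* There are b - 1 cones and r - b - 1 final edges, a count that needs b <= r - 1; the corners
     occupy the b rows from r - b + 1 to r. *)
  have -> : r = b.-1.+2 + (r - b).-1 by lia.
  have -> : (b.-1.+2 + (r - b).-1 - b).+1 = 2 + (r - b).-1 by lia.
  exact: realizable_corners.
exists 'I_m, (restrict (N := m) E); split.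
  by split=> [u w|u]; [apply: Esym|apply: Eirr].
move=> K beta; have [h1 h2] := hE K m (leqnn m).
have betaE := betti_edges (fun i j h => proj1 (h1 i j h)).
have lr : (r - b).+1 <= r by lia.
have le i j : beta i (i + j) <> 0 -> j <= r /\ i <= p (maxn j (r - b).+1).
  by move=> /betaE/h1.
have corner j : (r - b).+1 <= j -> j <= r -> beta (p j) (p j + j) <> 0.
  by move=> j1 j2; apply/betaE/h2.
split; first exact: (profile_regularity lr le corner).
have -> : b = (r - (r - b).+1).+1 by lia.
exact: (profile_extremal_number lr decr le corner).
Qed.
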